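(* Let $S$ be a rooted plane tree with $m\ge 1$ vertices and degree distribution sequence $d_S=(l,u,d_2,\dots,d_{m-1})$, and let $C=\prod_{i=3}^{m-1}(\boldsymbol{C}_{i-1})^{d_i}$. Then $a_{\mathcal{B}_n}(S)=g_{\mathcal{B}_n}(S)=0$ for even $n$, and as $n\to\infty$ through odd values, $$a_{\mathcal{B}_n}(S)\sim \frac{C\cdot 2^{\frac{5-m-3l}{2}}}{\Gamma(\frac{m+l-1}{2})}\cdot 2^n\cdot n^{\frac{m+l-3}{2}},$$ $$g_{\mathcal{B}_n}(S)\sim\begin{cases}\frac{C\cdot 2^{\frac{6-m-3l}{2}}}{\Gamma(\frac{m+l-2}{2})}\cdot 2^n\cdot n^{\frac{m+l-4}{2}} & \text{if } m+l-2>0,\\[2mm] \frac{\sqrt{2}\cdot 2^n}{\sqrt{\pi n^3}} & \text{if } m+l-2=0.\end{cases}$$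
   Context: $\mathcal{B}_n$ is the set of plane (ordered) binary trees with $n$ nodes (every node has $0$ or $2$ children, order of children matters). $\boldsymbol{C}_k=\frac{1}{k+1}\binom{2k}{k}$. For a rooted tree $S$ with $m$ vertices, $d_i$ is the number of vertices with $i$ children, $l=d_0$ (leaves), $u=d_1$. A rooted tree is viewed as a poset with $v\le w$ iff $w$ is an ancestor of $v$ or equal to it. For incomparable vertices $x,y$ of a plane tree, $x$ is left of $y$ if at their lowest common ancestor the child leading to $x$ precedes the child leading to $y$. A (plane) embedding of $S$ into a plane tree $T$ is a vertex subset $E$ of $T$ whose induced subposet is isomorphic to $S$ via an isomorphism preserving the left-to-right order of children of each vertex of $S$; it is good if $E$ contains the root of $T$. $a_{\mathcal{B}_n}(S)$ (resp. $g_{\mathcal{B}_n}(S)$) is the total number of embeddings (resp. good embeddings) of $S$ into all trees of $\mathcal{B}_n$. $f(n)\sim g(n)$ means $f(n)/g(n)\to1$. *)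

(* Defs.v *)
From Stdlib Require Import Reals.
From Coquelicot Require Import Coquelicot.
From mathcomp Require Import all_boot.

Set Implicit Arguments.
Local Open Scope nat_scope.
Unset Strict Implicit.
Unset Printing Implicit Defensive.

Inductive ptree : Type := PNode of seq ptree.

(* Vertices of a plane tree as Ulam-Harris words: the root is [::],
   the i-th child (0-based) of the vertex w is w ++ [:: i]. *)
Fixpoint verts (t : ptree) : seq (seq nat) :=
  let: PNode ts := t in
  [::] :: flatten [seq map (cons p.1) p.2
                  | p <- zip (iota 0 (size ts)) (map verts ts)].

Fixpoint degs (t : ptree) : seq nat :=
  let: PNode ts := t in size ts :: flatten (map degs ts).

Definition nverts (t : ptree) : nat := size (verts t).
Definition dcount (t : ptree) (i : nat) : nat := count (pred1 i) (degs t).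
Definition nleaves (t : ptree) : nat := dcount t 0.

Inductive btree : Type := BLeaf | BBin of btree & btree.

Fixpoint bt2pt (t : btree) : ptree :=
  match t with
  | BLeaf => PNode [::]
  | BBin l r => PNode [:: bt2pt l; bt2pt r]
  end.

Fixpoint bsize (t : btree) : nat :=
  match t with BLeaf => 1 | BBin l r => (bsize l + bsize r).+1 end.

(* all binary trees with at most n nodes (without repetition) *)
Fixpoint bt_size_le (n : nat) : seq btree :=
  match n with
  | 0 => [::]
  | n'.+1 => BLeaf :: [seq BBin p.1 p.2
                      | p <- [seq (l, r) | l <- bt_size_le n', r <- bt_size_le n']
                      & bsize p.1 + bsize p.2 <= n']
  end.

Definition Bn (n : nat) : seq btree :=
  [seq t <- bt_size_le n | bsize t == n].

(* v <= w in the tree poset iff w is an ancestor of v or equal: prefix w v. *)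
Definition tle (v w : seq nat) : bool := prefix w v.

(* x is left of y: incomparable and at the lowest common ancestor the child
   leading to x precedes the child leading to y. *)
Fixpoint leftof (x y : seq nat) : bool :=
  match x, y with
  | a :: x', b :: y' => (a < b) || ((a == b) && leftof x' y')
  | _, _ => false
  end.

Definition sib_before (x y : seq nat) : bool :=
  [&& 0 < size x, size x == size y,
      take (size x).-1 x == take (size y).-1 y & last 0 x < last 0 y].

Section Emb.
Variables (S T : ptree).
Let vS := verts S.
Let vT := verts T.
Let m := size vS.
Let k := size vT.
Definition svert (i : 'I_m) : seq nat := nth [::] vS i.
Definition tvert (j : 'I_k) : seq nat := nth [::] vT j.

Definition is_embedding (E : {set 'I_k}) : bool :=
  [exists phi : {ffun 'I_m -> 'I_k},
    [&& injectiveb phi,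
        [set phi i | i : 'I_m] == E,
        [forall i, forall j,
           tle (svert i) (svert j) == tle (tvert (phi i)) (tvert (phi j))] &
        [forall i, forall j,
           sib_before (svert i) (svert j) ==> leftof (tvert (phi i)) (tvert (phi j))]]].

Definition is_good_embedding (E : {set 'I_k}) : bool :=
  is_embedding E && [exists j in E, tvert j == [::]].

Definition n_emb : nat := #|[set E : {set 'I_k} | is_embedding E]|.
Definition n_good_emb : nat := #|[set E : {set 'I_k} | is_good_embedding E]|.
End Emb.

Definition aB (n : nat) (S : ptree) : nat :=
  \sum_(T <- Bn n) n_emb S (bt2pt T).
Definition gB (n : nat) (S : ptree) : nat :=
  \sum_(T <- Bn n) n_good_emb S (bt2pt T).

Definition catalan (k : nat) : nat := 'C(k.*2, k) %/ k.+1.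

Open Scope R_scope.

Definition Gamma (x : R) : R :=
  RInt_gen (fun t => Rpower t (x - 1) * exp (- t))
           (at_right 0) (Rbar_locally p_infty).

Definition asymp_odd (f g : nat -> R) : Prop :=
  is_lim_seq (fun k => f (2 * k + 1)%nat / g (2 * k + 1)%nat) 1.

Definition Cconst (S : ptree) : R :=
  \big[Rmult/1]_(3 <= i < nverts S) (INR (catalan i.-1) ^ dcount S i).
Close Scope R_scope.

(* Main.v *)
Require Import Defs.
From Stdlib Require Import Reals Lra Classical.
From Coquelicot Require Import Coquelicot.
From mathcomp Require Import all_boot.
Set Implicit Arguments.
Unset Strict Implicit.
Unset Printing Implicit Defensive.
Local Open Scope nat_scope.

(** The vertices of a plane tree in preorder are totally ordered, and an
    embedding preserves this order; so an embedding of [S] into [T] is a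
    subsequence of the vertices of [T] with the same matrix of "ancestor" and
    "left of" relations as [S].  Splitting at the root of a binary tree gives
    convolution recurrences for the number of embeddings of a forest.

    Let [z] mark internal nodes, [B = 1 + z B^2], [D = 1 - 2 z B], so that
    [D^2 = 1 - 4 z].  If [A] and [G] are the generating functions of embeddings
    and good embeddings then [D A = G], and a root with [r >= 2] children
    contributes a Catalan number of ways to split the forest, so that
    [2^l z G] is the product over the vertices of [S], with [d] children, of
    [C_(d-1) (1 - D)^[d <= 1] / D^(2d-1)] (with [2d-1] read as 0 for a leaf);
    the exponents [2d-1] add up to [m + l - 2].

    The coefficients of [D^(-j)] are
    [4^k Gamma(k + j/2) / (Gamma(j/2) Gamma(k + 1))], because [theta = z d/dz]
    satisfies [(1 - 4 z) theta (D^(-j)) = 2 j z D^(-j)].  Their size follows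
    from [Gamma(s + 1/2) <= sqrt s Gamma(s)] alone, and replacing [1] by
    [(1 - D)^q] only changes them by lower order terms.  The constant in the
    case [m = l = 1] is the Wallis product. *)

(** * The Gamma function at half-integers *)

Section GammaFunction.
Local Open Scope R_scope.

Definition gamma_integrand (s t : R) : R := Rpower t (s - 1) * exp (- t).

Definition is_gamma (s l : R) : Prop :=
  is_RInt_gen (gamma_integrand s) (at_right 0) (Rbar_locally p_infty) l.

Lemma is_gamma_unique (s l : R) : is_gamma s l -> Gamma s = l.
Proof. exact (is_RInt_gen_unique _ l). Qed.

(** The cutoff 1 makes the bounds satisfy [0 < a < b], so the integrand is smooth on the whole
    interval and no bound has to be reordered. *)
Lemma half_line_filter (P : R * R -> Prop) :
  (forall a b, 0 < a < 1 -> 1 < b -> P (a, b)) ->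
  filter_prod (at_right 0) (Rbar_locally p_infty) P.
Proof.
move=> H.
apply: (Filter_prod _ _ _ (fun a => 0 < a < 1) (fun b => 1 < b)).
- exists (mkposreal 1 Rlt_0_1) => y /=.
  rewrite /ball /= /AbsRing_ball /= /abs /minus /plus /opp /= => yb y0.
  split=> //; move: yb; rewrite Rabs_pos_eq; lra.
- by exists 1.
- by move=> a b; apply: H.
Qed.

Lemma gamma_integrand_pos (s t : R) : 0 < gamma_integrand s t.
Proof. by apply: Rmult_lt_0_compat; apply: exp_pos. Qed.

Lemma is_derive_Rpower (s t : R) : 0 < t ->
  is_derive (fun x => Rpower x s) t (s * Rpower t (s - 1)).
Proof.
by move=> t0; apply/is_derive_Reals/derivable_pt_lim_power.
Qed.

Lemma continuous_gamma_integrand (s t : R) : 0 < t ->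
  continuous (gamma_integrand s) t.
Proof.
move=> t0; apply: (@continuous_mult R_UniformSpace R_AbsRing).
  by apply: ex_derive_continuous; eexists; apply: is_derive_Rpower.
by apply: ex_derive_continuous; auto_derive.
Qed.

(* Monotone convergence: the integrals over compact subintervals are bounded
   through the primitive [h], so their supremum is the improper integral. *)
Lemma is_gamma_dominated (s M : R) (h dh : R -> R) :
  (forall t, 0 < t -> is_derive h t (dh t)) ->
  (forall t, 0 < t -> continuous dh t) ->
  (forall t, 0 < t -> gamma_integrand s t <= dh t) ->
  (forall t, 0 < t -> Rabs (h t) <= M) ->
  exists l, 0 < l /\ is_gamma s l.
Proof.
move=> hd dhc fh hM; set f := gamma_integrand s.
have fc a b : 0 < a -> a <= b -> ex_RInt f a b.
  move=> a0 ab; apply: ex_RInt_continuous => z.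
  rewrite Rmin_left // => -[az _]; apply: continuous_gamma_integrand; lra.
have f0 a b : 0 < a -> a <= b -> 0 <= RInt f a b.
  move=> a0 ab; apply: RInt_ge_0 => //; first exact: fc.
  by move=> x _; apply/Rlt_le/gamma_integrand_pos.
have mono a b c d : 0 < a -> a <= c -> c <= d -> d <= b -> RInt f c d <= RInt f a b.
  move=> a0 ac cd db.
  have E1 : RInt f a b = RInt f a c + RInt f c b.
    by symmetry; apply (RInt_Chasles f a c b); apply: fc; lra.
  have E2 : RInt f c b = RInt f c d + RInt f d b.
    by symmetry; apply (RInt_Chasles f c d b); apply: fc; lra.
  have := f0 a c a0 ac; have := f0 d b; lra.
pose E x := exists a b, 0 < a /\ a <= b /\ x = RInt f a b.
have [||l [lub1 lub2]] := completeness E.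
- exists (2 * M) => x [a [b [a0 [ab ->]]]].
  have D : is_RInt dh a b (minus (h b) (h a)).
    by apply: is_RInt_derive => z; rewrite Rmin_left // => -[az _];
      [apply: hd|apply: dhc]; lra.
  apply: Rle_trans (_ : minus (h b) (h a) <= _).
    apply: is_RInt_le ab (RInt_correct _ _ _ (fc _ _ a0 ab)) D _ => z [az _].
    by apply: fh; lra.
  rewrite /minus /plus /opp /=.
  have := hM a a0; have := hM b; move: (h a) (h b) => u v.
  by rewrite /Rabs; case: Rcase_abs; case: Rcase_abs; lra.
- exists (RInt f 1 1), 1, 1; lra.
exists l; split.
  apply: Rlt_le_trans (lub1 (RInt f 1 2) _); last by exists 1, 2; lra.
  apply: RInt_gt_0; first lra.
    by move=> x _; apply: gamma_integrand_pos.
  by move=> x x1; apply: continuous_gamma_integrand; lra.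
apply/filterlimi_locally => eps.
have [a [b [a0 [ab lab]]]] : exists a b, 0 < a /\ a <= b /\ l - eps < RInt f a b.
  apply: NNPP => N; have : l <= l - eps.
    apply: lub2 => x [a [b [a0 [ab ->]]]].
    by apply: Rnot_lt_le => H; apply: N; exists a, b.
  by have := cond_pos eps; lra.
apply: (Filter_prod _ _ _ (fun c => 0 < c < a) (fun d => b < d)).
- exists (mkposreal a a0) => y /=.
  rewrite /ball /= /AbsRing_ball /= /abs /minus /plus /opp /= => yb y0.
  split=> //; move: yb; rewrite Rabs_pos_eq; lra.
- by exists b.
move=> c d /= [c0 ca] bd.
exists (RInt f c d); split; first by apply: RInt_correct; apply: fc; lra.
rewrite /ball /= /AbsRing_ball /= /abs /minus /plus /opp /=.
have H1 := mono c d a b c0 (Rlt_le _ _ ca) ab (Rlt_le _ _ bd).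
have H2 : RInt f c d <= l by apply: lub1; exists c, d; lra.
have := cond_pos eps; rewrite /Rabs; case: Rcase_abs; lra.
Qed.

(** Since [exp t >= 1 + t], the integrand is at most [1 / (sqrt t * (1 + t))], the derivative of the
    bounded function [2 * atan (sqrt t)]. *)
Lemma is_gamma_half : exists l, 0 < l /\ is_gamma (1 / 2) l.
Proof.
apply: (@is_gamma_dominated (1 / 2) PI (fun t => 2 * atan (sqrt t))
  (fun t => / (sqrt t * (1 + t)))).
- move=> t t0; have s0 := sqrt_lt_R0 _ t0.
  auto_derive; first lra.
  have := sqrt_sqrt t (Rlt_le _ _ t0); move: (sqrt t) s0 => r r0 <-.
  by rewrite /Rsqr; field; split; nra.
- move=> t t0; have s0 := sqrt_lt_R0 _ t0.
  apply: ex_derive_continuous; auto_derive; split; first lra.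
  split=> //; apply: Rmult_integral_contrapositive; lra.
- move=> t t0; have s0 := sqrt_lt_R0 _ t0.
  rewrite /gamma_integrand (_ : 1 / 2 - 1 = - / 2); last lra.
  rewrite Rpower_Ropp Rpower_sqrt // Rinv_mult.
  apply: Rmult_le_compat_l; first exact/Rlt_le/Rinv_0_lt_compat.
  rewrite exp_Ropp; apply: Rinv_le_contravar; first lra.
  by have := exp_ineq1_le t; lra.
move=> t t0; have := atan_bound (sqrt t) => H.
by rewrite /Rabs; case: Rcase_abs; lra.
Qed.

(** Writing [t^s exp(-t)] as [exp (t * (s * ln t / t - 1))], the exponent tends to minus infinity
    because [ln t / t] tends to 0. The sign is that of the boundary term in the integration by parts
    below. *)
Lemma Rpower_exp_infty (s : R) :
  is_lim (fun t => - (Rpower t s * exp (- t))) p_infty 0.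
Proof.
have H : is_lim (fun t => t * (s * (ln t / t) - 1)) p_infty m_infty.
  have -> : m_infty = Rbar_mult p_infty (Rbar.Finite (-1)).
    by rewrite /Rbar_mult /=; case: Rle_dec => [H|//]; exfalso; lra.
  apply: is_lim_mult; last by rewrite /ex_Rbar_mult; lra.
    exact: is_lim_id.
  rewrite (_ : Rbar.Finite (-1) = Rbar.Finite (s * 0 - 1)); last by congr Rbar.Finite; lra.
  apply: is_lim_minus'; last exact: is_lim_const.
  apply: (is_lim_scal_l _ s p_infty 0); exact: is_lim_div_ln_p.
rewrite -Ropp_0; apply: (is_lim_opp _ p_infty 0).
apply: (is_lim_ext_loc (fun t => exp (t * (s * (ln t / t) - 1)))).
  exists 0 => t t0; rewrite /Rpower -exp_plus; congr exp; field; lra.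
apply: (is_lim_comp _ _ _ _ m_infty); [exact: is_lim_exp_m|exact: H|].
by exists 0.
Qed.

Lemma Rpower_exp_zero (s : R) : 0 < s ->
  filterlim (fun t => - (Rpower t s * exp (- t))) (at_right 0) (locally 0).
Proof.
move=> s0; rewrite [in locally _](_ : 0 = - (0 * exp (- 0))); last by ring.
apply: (filterlim_comp _ _ _ _ Ropp _ (locally (0 * exp (- 0)))); last first.
  exact: (filterlim_opp (0 * exp (- 0))).
apply: (filterlim_comp_2 (G := locally 0) (H := locally (exp (- 0)))).
- apply: (filterlim_comp _ _ _ (fun t => s * ln t) exp _ (Rbar_locally m_infty)).
    apply: (filterlim_comp _ _ _ ln (fun y => s * y) _ (Rbar_locally m_infty)).
      exact: is_lim_ln_0.
    have := filterlim_Rbar_mult_l s m_infty; rewrite /Rbar_mult /=.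
    case: Rle_dec => [H|]; last lra.
    by case: Rle_lt_or_eq_dec => [_ +|]; last lra.
  exact: is_lim_exp_m.
- have C : continuous (fun t => exp (- t)) 0.
    by apply: ex_derive_continuous; auto_derive.
  apply: filterlim_filter_le_1 C; exact: filter_le_within.
exact: (filterlim_mult 0 (exp (- 0))).
Qed.

Lemma is_gamma_one : is_gamma 1 1.
Proof.
pose h t := - exp (- t).
have hd t : is_derive h t (exp (- t)) by rewrite /h; auto_derive => //; ring.
have hD : is_RInt_gen (Derive h) (at_right 0) (Rbar_locally p_infty) (0 - - exp (- 0)).
  apply: is_RInt_gen_Derive.
  - by apply: half_line_filter => a b _ _ x _; eexists; apply: hd.
  - apply: half_line_filter => a b _ _ x _.
    apply: (continuous_ext (fun t => exp (- t))) => [t|].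
      by symmetry; apply: is_derive_unique.
    by apply: ex_derive_continuous; auto_derive.
  - have C : continuous h 0 by apply: ex_derive_continuous; eexists; apply: hd.
    apply: filterlim_filter_le_1 C; exact: filter_le_within.
  apply (is_lim_ext_loc (fun t => - (Rpower t 0 * exp (- t))) h p_infty 0).
    by exists 0 => t t0; rewrite Rpower_O // Rmult_1_l.
  exact: Rpower_exp_infty.
rewrite Ropp_0 exp_0 (_ : 0 - - (1) = 1) in hD; last by ring.
refine (is_RInt_gen_ext _ (gamma_integrand 1) _ _ hD).
apply: half_line_filter => a b a01 b1 x /=; rewrite Rmin_left; last lra.
move=> [ax _]; rewrite (is_derive_unique _ _ _ (hd x)) /gamma_integrand Rminus_diag.
by rewrite Rpower_O ?Rmult_1_l //; lra.
Qed.

(** Integration by parts: the derivative of [- t^s exp(-t)] is the integrand at [s + 1] minus [s]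
    times the integrand at [s], and the boundary terms vanish at both ends. *)
Lemma is_gamma_succ (s l : R) : 0 < s -> is_gamma s l -> is_gamma (s + 1) (s * l).
Proof.
move=> s0 gl.
pose h t := - (Rpower t s * exp (- t)).
have hd t : 0 < t -> is_derive h t (gamma_integrand (s + 1) t - s * gamma_integrand s t).
  move=> t0; have := is_derive_Rpower s t0 => D.
  rewrite /h /gamma_integrand (_ : s + 1 - 1 = s); last ring.
  have -> : Rpower t s * exp (- t) - s * (Rpower t (s - 1) * exp (- t)) =
    opp (plus (mult (s * Rpower t (s - 1)) (exp (- t)))
              (mult (Rpower t s) (- exp (- t)))).
    by rewrite /opp /plus /mult /=; ring.
  apply: is_derive_opp; apply: is_derive_mult => //; last exact: Rmult_comm.
  by auto_derive => //; ring.
have hD : is_RInt_gen (Derive h) (at_right 0) (Rbar_locally p_infty) (0 - 0).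
  apply: is_RInt_gen_Derive.
  - apply: half_line_filter => a b a01 b1 x /=; rewrite Rmin_left; last lra.
    by move=> [ax _]; eexists; apply: hd; lra.
  - apply: half_line_filter => a b a01 b1 x /=; rewrite Rmin_left; last lra.
    move=> [ax _]; have x0 : 0 < x by lra.
    apply: (continuous_ext_loc _ (fun t => minus (gamma_integrand (s + 1) t)
        (scal s (gamma_integrand s t)))).
      exists (mkposreal x x0) => y.
      rewrite /ball /= /AbsRing_ball /= /abs /minus /plus /opp /= => yx.
      symmetry; apply: is_derive_unique; apply: hd.
      by move: yx; rewrite /Rabs; case: Rcase_abs; lra.
    apply: continuous_minus; first exact: continuous_gamma_integrand.
    by apply: continuous_scal_r; apply: continuous_gamma_integrand.
  - exact: Rpower_exp_zero.
  exact: Rpower_exp_infty.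
have := is_RInt_gen_plus _ _ _ _ hD (is_RInt_gen_scal _ s _ gl).
rewrite (_ : plus _ _ = s * l); last by rewrite /plus /scal /= /mult /=; ring.
move=> H; refine (is_RInt_gen_ext _ (gamma_integrand (s + 1)) _ _ (H _ _ _ _)).
apply: half_line_filter => a b a01 b1 x /=.
rewrite Rmin_left; last lra.
move=> [ax _]; rewrite (is_derive_unique _ _ _ (hd x _)); last lra.
by rewrite /plus /scal /= /mult /=; ring.
Qed.

(* AM-GM: [t^(s-1/2) <= (c t^(s-1) + t^s / c) / 2] with [c = sqrt s]. *)
Lemma is_gamma_half_step (s l l' : R) : 0 < s ->
  is_gamma s l -> is_gamma (s + 1 / 2) l' -> l' <= sqrt s * l.
Proof.
move=> s0 gl gl'; set c := sqrt s.
have c0 : 0 < c by apply: sqrt_lt_R0.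
have cc : c * c = s by apply: sqrt_sqrt; lra.
have H := is_RInt_gen_plus _ _ _ _ (is_RInt_gen_scal _ (c / 2) _ gl)
  (is_RInt_gen_scal _ (/ (2 * c)) _ (is_gamma_succ s0 gl)).
have -> : sqrt s * l = plus (scal (c / 2) l) (scal (/ (2 * c)) (s * l)).
  rewrite /plus /scal /= /mult /= -/c -cc; field; lra.
apply: Rle_trans (Rle_abs _) _.
refine (RInt_gen_norm _ _ _ _ _ _ gl' (H _ _ _ _ _ _)).
  by apply: half_line_filter => a b a01 b1 /=; lra.
apply: half_line_filter => a b a01 b1 x /= x1.
have x0 : 0 < x by lra.
rewrite /norm /= /abs /= Rabs_pos_eq; last exact/Rlt_le/gamma_integrand_pos.
rewrite /plus /scal /= /mult /= /gamma_integrand.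
have r0 := sqrt_lt_R0 _ x0; set r := sqrt x in r0.
have E1 : Rpower x (s + 1 / 2 - 1) = Rpower x (s - 1) * r.
  by rewrite /r -Rpower_sqrt // -Rpower_plus; congr Rpower; lra.
have E2 : Rpower x (s + 1 - 1) = Rpower x (s - 1) * (r * r).
  rewrite /r sqrt_sqrt; last lra.
  by rewrite -{3}(Rpower_1 x) // -Rpower_plus; congr Rpower; lra.
rewrite E1 E2.
have P0 : 0 < Rpower x (s - 1) * exp (- x) by apply: Rmult_lt_0_compat; apply: exp_pos.
have -> : c / 2 * (Rpower x (s - 1) * exp (- x)) +
  / (2 * c) * (Rpower x (s - 1) * (r * r) * exp (- x)) =
  Rpower x (s - 1) * exp (- x) * ((c * c + r * r) / (2 * c)) by field; lra.
have -> : Rpower x (s - 1) * r * exp (- x) = Rpower x (s - 1) * exp (- x) * r by ring.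
apply: Rmult_le_compat_l; first lra.
apply: (Rmult_le_reg_r (2 * c)); first lra.
have -> : (c * c + r * r) / (2 * c) * (2 * c) = c * c + r * r by field; lra.
by have := Rle_0_sqr (c - r); rewrite /Rsqr; lra.
Qed.

(** Indexing by twice the argument turns half-integers into naturals. The facts below concern
    successor indices, since the integral diverges at argument 0. *)
Definition gammah (n : nat) : R := Gamma (INR n / 2).

(** Induction in steps of two from the arguments 1/2 and 1, through the functional equation. *)
Lemma is_gamma_gammah n : 0 < gammah n.+1 /\ is_gamma (INR n.+1 / 2) (gammah n.+1).
Proof.
suff: exists l, 0 < l /\ is_gamma (INR n.+1 / 2) l.
  by move=> [l [l0 gl]]; rewrite /gammah (is_gamma_unique gl).
have step k : (exists l, 0 < l /\ is_gamma (INR k.+1 / 2) l) ->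
    exists l, 0 < l /\ is_gamma (INR k.+3 / 2) l.
  move=> [l [l0 gl]]; have k0 : 0 < INR k.+1 / 2.
    by have := pos_INR k; rewrite S_INR; lra.
  exists (INR k.+1 / 2 * l); split; first exact: Rmult_lt_0_compat.
  have -> : INR k.+3 / 2 = INR k.+1 / 2 + 1 by rewrite (S_INR k.+2) (S_INR k.+1); lra.
  exact: is_gamma_succ.
elim: n {-2}n (leqnn n) => [|m IH] [|[|n]] //= nm.
- exact: is_gamma_half.
- exact: is_gamma_half.
- exists 1; split; first lra.
  by have := is_gamma_one; rewrite (_ : (1 + 1) / 2 = 1) //; lra.
apply: step; apply: IH; exact: ltnW.
Qed.

Lemma gammah2 : gammah 2 = 1.
Proof.
have := is_gamma_unique is_gamma_one.
by rewrite /gammah (_ : INR 2 / 2 = 1) //=; lra.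
Qed.

Lemma gammah_gt0 n : 0 < gammah n.+1.
Proof. by have [] := is_gamma_gammah n. Qed.

Lemma gammahSS n : gammah n.+3 = INR n.+1 / 2 * gammah n.+1.
Proof.
have [_ gn] := is_gamma_gammah n.
apply: is_gamma_unique.
have -> : INR n.+3 / 2 = INR n.+1 / 2 + 1 by rewrite (S_INR n.+2) (S_INR n.+1); lra.
by apply: is_gamma_succ => //; have := pos_INR n; rewrite S_INR; lra.
Qed.

Lemma gammahS_le n : gammah n.+2 <= sqrt (INR n.+1 / 2) * gammah n.+1.
Proof.
have [_ gn] := is_gamma_gammah n; have [_ gn'] := is_gamma_gammah n.+1.
apply: is_gamma_half_step gn _; first by have := pos_INR n; rewrite S_INR; lra.
by move: gn'; rewrite (S_INR n.+1) (_ : (INR n.+1 + 1) / 2 = INR n.+1 / 2 + 1 / 2) //; lra.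
Qed.
End GammaFunction.

(** * Quotients of Gamma values at half-integers and growth of coefficients *)

Section HalfIntegerAsymptotics.
Local Open Scope R_scope.

Lemma Rpower_div (x y s : R) : 0 < x -> 0 < y ->
  Rpower (x / y) s = Rpower x s / Rpower y s.
Proof.
move=> x0 y0; rewrite /Rdiv /Rpower ln_mult ?ln_Rinv //; last exact: Rinv_0_lt_compat.
by rewrite -exp_Ropp -exp_plus; congr exp; ring.
Qed.

Lemma is_lim_seq_affine_ratio (a b c : R) : 0 < c ->
  is_lim_seq (fun k => (c * INR k + a) / (c * INR k + b)) 1.
Proof.
move=> c0.
have H : is_lim_seq (fun k => c * INR k + b) p_infty.
  apply: (is_lim_seq_plus _ _ p_infty b); last 1 first.
  - by [].
  - rewrite (_ : p_infty = Rbar_mult c p_infty); last first.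
      rewrite /Rbar_mult /=; case: Rle_dec => [H|]; last by lra.
      by case: Rle_lt_or_eq_dec => // E; exfalso; lra.
    apply: is_lim_seq_scal_l; exact: is_lim_seq_INR.
  exact: is_lim_seq_const.
rewrite (_ : 1 = 1 + (a - b) * 0); last by ring.
apply: (is_lim_seq_ext_loc (fun k => 1 + (a - b) * / (c * INR k + b))).
  have [N HN] := proj2 (is_lim_seq_spec _ _) H 0.
  by exists N => k /HN k0; field; lra.
apply: is_lim_seq_plus'; first exact: is_lim_seq_const.
apply: (is_lim_seq_scal_l _ (a - b) 0).
by apply: (is_lim_seq_inv _ p_infty).
Qed.

Lemma is_lim_seq_sqrt_ratio (a b c : R) : 0 < c ->
  is_lim_seq (fun k => sqrt ((c * INR k + a) / (c * INR k + b))) 1.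
Proof.
move=> c0; rewrite -sqrt_1.
apply: is_lim_seq_continuous; last exact: is_lim_seq_affine_ratio.
apply: continuity_pt_sqrt; lra.
Qed.

(** Squeeze: [gammahS_le] at [n] bounds the ratio by 1. At [n + 1], combined with the functional
    equation, it bounds the ratio below by [sqrt ((n + 1) / (n + 2))]. *)
Lemma gammah_ratio j :
  is_lim_seq (fun k => gammah (2 * k + j).+2 /
    (sqrt (INR (2 * k + j).+1 / 2) * gammah (2 * k + j).+1)) 1.
Proof.
apply: (is_lim_seq_le_le (fun k => sqrt ((2 * INR k + (INR j + 1)) / (2 * INR k + (INR j + 2)))) _ (fun=> 1)).
- move=> k; set n := (2 * k + j)%N.
  have n0 := pos_INR n.
  have g1 := gammah_gt0 n; have g2 := gammah_gt0 n.+1.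
  have s1 : 0 < sqrt (INR n.+1 / 2) by apply: sqrt_lt_R0; rewrite S_INR; lra.
  have s2 : 0 < sqrt (INR n.+2 / 2) by apply: sqrt_lt_R0; rewrite !S_INR; lra.
  have d0 : 0 < sqrt (INR n.+1 / 2) * gammah n.+1 by apply: Rmult_lt_0_compat.
  split; last first.
    apply: (Rmult_le_reg_r _ _ _ d0); rewrite /Rdiv Rmult_assoc Rinv_l; last lra.
    by have := gammahS_le n; lra.
  apply: (Rmult_le_reg_r _ _ _ d0).
  rewrite (_ : _ / _ * _ = gammah n.+2); last by field; lra.
  have := gammahS_le n.+1; rewrite gammahSS => H.
  have -> : (2 * INR k + (INR j + 1)) / (2 * INR k + (INR j + 2)) =
    (INR n.+1 / 2) / (INR n.+2 / 2).
    rewrite /n !S_INR plus_INR mult_INR /=; field.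
    by have := pos_INR k; have := pos_INR j; lra.
  rewrite sqrt_div_alt; last by rewrite !S_INR; lra.
  apply: (Rmult_le_reg_l _ _ _ s2).
  apply: Rle_trans H.
  have E : sqrt (INR n.+1 / 2) * sqrt (INR n.+1 / 2) = INR n.+1 / 2.
    by apply: sqrt_sqrt; rewrite S_INR; lra.
  rewrite -{3}E; right; field; lra.
- by apply: is_lim_seq_sqrt_ratio; lra.
exact: is_lim_seq_const.
Qed.

(** This is Gamma(k + j/2) ~ Gamma(k + 1) k^(j/2 - 1), read at [k.+1] to keep the base of the power
    positive. For [j = 0] it is an equality, by the functional equation; each further half step
    multiplies by a square root through [gammah_ratio]. *)
Lemma gammah_quotient j :
  is_lim_seq (fun k => gammah (2 * k.+1 + j) /
    (gammah (2 * k.+1).+2 * Rpower (INR k.+1) (INR j / 2 - 1))) 1.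
Proof.
elim: j => [|j IH].
  apply: (is_lim_seq_ext (fun=> 1)); last exact: is_lim_seq_const.
  move=> k; rewrite addn0 mulnS; have g := gammah_gt0 (2 * k).+1.
  rewrite add2n gammahSS.
  rewrite (_ : INR 0 / 2 - 1 = - (1)); last by rewrite /=; lra.
  have k0 : 0 < INR k.+1 by rewrite S_INR; have := pos_INR k; lra.
  rewrite Rpower_Ropp Rpower_1 //.
  have -> : INR (2 * k).+2 / 2 = INR k.+1 by rewrite !S_INR mult_INR /=; lra.
  by field; lra.
have H := is_lim_seq_mult' _ _ _ _ IH (is_lim_seq_mult' _ _ _ _
  (gammah_ratio j.+1) (is_lim_seq_sqrt_ratio (INR j + 2) 2 (c := 2) Rlt_0_2)).
rewrite !Rmult_1_l in H; apply: is_lim_seq_ext H => k.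
have j0 := pos_INR j; have k0 := pos_INR k.
have e1 : (2 * k.+1 + j = (2 * k + j.+1).+1)%N by rewrite mulnS addnS.
have -> : (2 * k.+1 + j.+1 = (2 * k + j.+1).+2)%N by rewrite addnS e1.
rewrite e1; set n := (2 * k + j.+1)%N.
have n2 : INR n.+1 = 2 * INR k + (INR j + 2).
  by rewrite /n !S_INR plus_INR mult_INR !S_INR /=; lra.
have g1 := gammah_gt0 n; have g2 := gammah_gt0 (2 * k.+1).+1.
have s1 : 0 < sqrt (INR n.+1 / 2) by apply: sqrt_lt_R0; lra.
have s2 : 0 < sqrt (INR k.+1) by apply: sqrt_lt_R0; rewrite S_INR; lra.
have p1 : 0 < Rpower (INR k.+1) (INR j / 2 - 1) by apply: exp_pos.
have -> : INR j.+1 / 2 - 1 = (INR j / 2 - 1) + / 2 by rewrite S_INR; lra.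
have k1 : 0 < INR k.+1 by rewrite S_INR; lra.
rewrite Rpower_plus (Rpower_sqrt _ k1).
have -> : (2 * INR k + (INR j + 2)) / (2 * INR k + 2) = INR n.+1 / 2 / INR k.+1.
  by rewrite n2 S_INR; field; lra.
by rewrite (sqrt_div_alt (INR n.+1 / 2)) //; field; lra.
Qed.

Lemma is_lim_seq_shift_sqrt :
  is_lim_seq (fun k => sqrt (INR k.+2) / sqrt (INR k.+1)) 1.
Proof.
apply: is_lim_seq_ext (is_lim_seq_sqrt_ratio 2 1 (c := 1) Rlt_0_1) => k.
have k0 := pos_INR k.
rewrite -sqrt_div_alt; last by rewrite S_INR; lra.
by congr sqrt; rewrite !S_INR; congr (_ / _); lra.
Qed.

(* The coefficients [u q j k] of [(1 - sqrt (1 - 4 z))^q (1 - 4 z)^(-j/2)],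
   through the recurrences that characterize them. *)
Section Coefficients.
Variable u : nat -> nat -> nat -> R.
Hypothesis u0 : forall j, u 0 j 0 = 1.
Hypothesis uS : forall j n,
  INR (2 * n.+1) * u 0 j n.+1 = INR (4 * (2 * n + j)) * u 0 j n.
Hypothesis u_step : forall q j n, u q.+1 j.+1 n = u q j.+1 n - u q j n.
(** Lowering [j] below 0 is avoided by writing D as (1 - 4z) D^(-1), which brings in two consecutive
    coefficients at [j = 1]. *)
Hypothesis u_step0 : forall q n,
  u q.+1 0%N n.+1 = u q 0%N n.+1 - (u q 1%N n.+1 - 4 * u q 1%N n).

(** Both sides satisfy the same first-order recurrence in [k]. The factor [gammah 2], which equals
    1, makes the two sides cancel at [k = 0]. *)
Lemma u_gammah j k :
  u 0 j.+1 k = 4 ^ k * gammah (2 * k + j.+1) * gammah 2 / (gammah j.+1 * gammah (2 * k).+2).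
Proof.
elim: k => [|k IH].
  have := gammah_gt0 j; have := gammah_gt0 1.
  by rewrite u0 muln0 add0n => *; field; lra.
have k0 := pos_INR k; have j0 := pos_INR j.
have g1 := gammah_gt0 j; have g2 := gammah_gt0 (2 * k).+1.
have g3 := gammah_gt0 (2 * k + j).
apply: (Rmult_eq_reg_l (INR (2 * k.+1))); last by rewrite mult_INR (S_INR k) /=; lra.
rewrite uS IH.
have -> : (2 * k.+1 + j.+1 = (2 * k + j).+3)%N by rewrite mulnS !addnS.
have -> : (2 * k.+1 = (2 * k).+2)%N by rewrite mulnS.
rewrite addnS !gammahSS.
have e1 : INR (2 * k).+2 = 2 * INR k + 2 by rewrite !S_INR mult_INR /=; lra.
have e2 : INR (2 * k + j).+1 = 2 * INR k + INR j + 1.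
  by rewrite S_INR plus_INR mult_INR /=; lra.
have e3 : INR (4 * (2 * k + j).+1) = 4 * (2 * INR k + INR j + 1).
  by rewrite mult_INR e2 /=; lra.
by rewrite e1 e2 e3 -tech_pow_Rmult; field; lra.
Qed.

(** The coefficient divided by its expected order of growth 4^k k^(j/2 - 1). The index is shifted by
    one so that the base of the power is never 0. *)
Definition unorm q j k := u q j k.+1 / (4 ^ k.+1 * Rpower (INR k.+1) (INR j / 2 - 1)).

Lemma unorm_lim0 j : is_lim_seq (unorm 0 j.+1) (/ gammah j.+1).
Proof.
have H := is_lim_seq_scal_l _ (/ gammah j.+1) _ (gammah_quotient j.+1).
rewrite [Rbar_mult _ _]/= Rmult_1_r in H; apply: is_lim_seq_ext H => k.
have g1 := gammah_gt0 j; have g2 := gammah_gt0 (2 * k.+1).+1.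
have p1 : 0 < Rpower (INR k.+1) (INR j.+1 / 2 - 1) by apply: exp_pos.
have p4 : 0 < 4 ^ k.+1 by apply: pow_lt; lra.
by rewrite /unorm u_gammah gammah2; field; lra.
Qed.

(** Lowering [j] by one lowers the order of growth by a factor [sqrt k], so the second term is
    negligible. *)
Lemma unorm_step q j k : unorm q.+1 j.+2 k =
  unorm q j.+2 k - unorm q j.+1 k * / sqrt (INR k.+1).
Proof.
rewrite /unorm u_step.
have k0 : 0 < INR k.+1 by rewrite S_INR; have := pos_INR k; lra.
have -> : INR j.+2 / 2 - 1 = (INR j.+1 / 2 - 1) + / 2 by rewrite (S_INR j.+1); lra.
rewrite Rpower_plus Rpower_sqrt //.
have p1 : 0 < Rpower (INR k.+1) (INR j.+1 / 2 - 1) by apply: exp_pos.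
have p4 : 0 < 4 ^ k.+1 by apply: pow_lt; lra.
by have := sqrt_lt_R0 _ k0; move=> s0; field; lra.
Qed.

Lemma unorm_one q k : unorm q 1 k = u q 1%N k.+1 / 4 ^ k.+1 * sqrt (INR k.+1).
Proof.
have k0 : 0 < INR k.+1 by rewrite S_INR; have := pos_INR k; lra.
rewrite /unorm (_ : INR 1 / 2 - 1 = - / 2); last by rewrite /=; lra.
rewrite Rpower_Ropp Rpower_sqrt //.
have p4 : 0 < 4 ^ k.+1 by apply: pow_lt; lra.
by have := sqrt_lt_R0 _ k0; move=> s0; field; lra.
Qed.

Lemma is_lim_seq_inv_sqrt : is_lim_seq (fun k => / sqrt (INR k.+1)) 0.
Proof.
apply: (is_lim_seq_inv _ p_infty) => //.
apply: (filterlim_comp _ _ _ (fun k => INR k.+1) sqrt _ (Rbar_locally p_infty)).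
  exact: (proj1 (is_lim_seq_incr_1 INR p_infty) is_lim_seq_INR).
exact: filterlim_sqrt_p.
Qed.

(** Induction on [q]: a factor 1 - D leaves the leading term unchanged. The case [j = 0] is measured
    on the scale of [j = 1], where it must be shown negligible because the step from [q] to [q.+1]
    at [j = 1] subtracts it. *)
Lemma unorm_lim q :
  is_lim_seq (fun k => u q 0%N k.+1 / 4 ^ k.+1 * sqrt (INR k.+1)) 0 /\
  forall j, is_lim_seq (unorm q j.+1) (/ gammah j.+1).
Proof.
elim: q => [|q [IH0 IH]].
  (* For [q = j = 0] the series is 1: its recurrence has the factor [4 * (2 * n)], which kills every
     coefficient after the first. *)
  split; last exact: unorm_lim0.
  apply: (is_lim_seq_ext (fun=> 0)); last exact: is_lim_seq_const.
  move=> k; suff -> : u 0 0%N k.+1 = 0 by rewrite /Rdiv !Rmult_0_l.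
  have n0 n : INR (2 * n.+1) <> 0 by apply: not_0_INR; rewrite mulnS.
  elim: k => [|k IHk].
    by apply: (Rmult_eq_reg_l _ _ _ _ (n0 0%N)); rewrite uS Rmult_0_l Rmult_0_r.
  by apply: (Rmult_eq_reg_l _ _ _ _ (n0 k.+1)); rewrite uS IHk !Rmult_0_r.
split=> [|[|j]].
(* In [u_step0] the two coefficients at [j = 1] have the same normalized limit, so they cancel to
   leading order. The shift makes both of their indices successors. *)
- apply/is_lim_seq_incr_1.
  have S0 := proj1 (is_lim_seq_incr_1 _ _) IH0.
  have S1 := proj1 (is_lim_seq_incr_1 _ _) (IH 0%N).
  have H := is_lim_seq_minus' _ _ _ _ S0 (is_lim_seq_minus' _ _ _ _ S1
    (is_lim_seq_mult' _ _ _ _ (IH 0%N) is_lim_seq_shift_sqrt)).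
  rewrite (_ : 0 - _ = 0) in H; last by lra.
  apply: is_lim_seq_ext H => k; rewrite !unorm_one u_step0.
  have s0 : 0 < sqrt (INR k.+1).
    by apply: sqrt_lt_R0; rewrite S_INR; have := pos_INR k; lra.
  have p4 : 0 < 4 ^ k.+1 by apply: pow_lt; lra.
  by rewrite -(tech_pow_Rmult _ k.+1); field; lra.
- have H := is_lim_seq_minus' _ _ _ _ (IH 0%N) IH0.
  rewrite Rminus_0_r in H; apply: is_lim_seq_ext H => k.
  rewrite !unorm_one u_step.
  have p4 : 0 < 4 ^ k.+1 by apply: pow_lt; lra.
  by field; lra.
have H := is_lim_seq_minus' _ _ _ _ (IH j.+1)
  (is_lim_seq_mult' _ _ _ _ (IH j) is_lim_seq_inv_sqrt).
rewrite Rmult_0_r Rminus_0_r in H; apply: is_lim_seq_ext H => k.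
by rewrite unorm_step.
Qed.

(** With n = 2k + 1 the coefficient index k + 1 is (n + 1)/2, so 4^(k+1) = 2 * 2^n and (k + 1)^s =
    (n + 1)^s / 2^s with s = (j + 1)/2 - 1. Here (n + 1)^s may be replaced by n^s, and the remaining
    powers of 2 form the stated constant. *)
Lemma asymp_of_coefficient (f : nat -> nat) (c q j l : nat) :
  (0 < c)%N -> (forall k, 2 ^ l * INR (f k) = INR c * u q j.+1 k.+1) ->
  is_lim_seq (fun k => INR (f k) /
    (INR c * Rpower 2 ((4 - INR j.+1 - 2 * INR l) / 2) / Gamma (INR j.+1 / 2)
     * 2 ^ (2 * k + 1) * Rpower (INR (2 * k + 1)) (INR j.+1 / 2 - 1))) 1.
Proof.
move=> c0 fE; set s := INR j.+1 / 2 - 1.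
have R1 : is_lim_seq (fun k => Rpower ((2 * INR k + 2) / (2 * INR k + 1)) s) 1.
  rewrite -(_ : Rpower 1 s = 1); last by rewrite /Rpower ln_1 Rmult_0_r exp_0.
  apply: (is_lim_seq_continuous (fun x => Rpower x s)).
    apply: derivable_continuous_pt; exists (s * Rpower 1 (s - 1)).
    by apply: derivable_pt_lim_power; lra.
  by apply: is_lim_seq_affine_ratio; lra.
have g0 := gammah_gt0 j.
have H := is_lim_seq_mult' _ _ _ _ (is_lim_seq_scal_l _ (gammah j.+1) _
  (proj2 (unorm_lim q) j)) R1.
rewrite Rinv_r ?Rmult_1_l in H; last by lra.
apply: is_lim_seq_ext H => k; rewrite -/(gammah j.+1) /unorm -/s.
have k0 := pos_INR k.
have c0' : 0 < INR c by apply: lt_0_INR; apply/ltP.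
have l0 : 0 < 2 ^ l by apply: pow_lt; lra.
have -> : u q j.+1 k.+1 = 2 ^ l * INR (f k) / INR c by rewrite fE; field; lra.
have e1 : INR (2 * k + 1) = 2 * INR k + 1 by rewrite plus_INR mult_INR /=; lra.
have e2 : INR k.+1 = (2 * INR k + 2) / 2 by rewrite S_INR; lra.
rewrite e1 e2 !Rpower_div; try lra.
have -> : Rpower 2 ((4 - INR j.+1 - 2 * INR l) / 2) = 2 / (2 ^ l * Rpower 2 s).
  have -> : (4 - INR j.+1 - 2 * INR l) / 2 = 1 + (- INR l + - s) by rewrite /s; lra.
  clearbody s.
  rewrite !Rpower_plus !Rpower_Ropp Rpower_1 ?Rpower_pow; try lra.
  by rewrite /Rdiv Rinv_mult.
have -> : 4 ^ k.+1 = 2 * 2 ^ (2 * k + 1).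
  rewrite addn1 tech_pow_Rmult (_ : (2 * k).+2 = (2 * k.+1)%N); last by rewrite mulnS.
  by rewrite -multE pow_mult (_ : 2 ^ 2 = 4) //=; lra.
have p0 x : 0 < Rpower x s by apply: exp_pos.
have := p0 2; have := p0 (2 * INR k + 2); have := p0 (2 * INR k + 1).
have : 0 < 2 ^ (2 * k + 1) by apply: pow_lt; lra.
by move=> *; field; lra.
Qed.
End Coefficients.

End HalfIntegerAsymptotics.

(** * Wallis integrals and the value of Gamma at 1/2 *)

Section Wallis.
Local Open Scope R_scope.

Definition wallis (n : nat) : R := RInt (fun x => sin x ^ n) 0 (PI / 2).

Lemma ex_RInt_sin_pow n a b : ex_RInt (fun x => sin x ^ n) a b.
Proof.
by apply: ex_RInt_continuous => z _; apply: ex_derive_continuous; auto_derive.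
Qed.

Lemma wallis0 : wallis 0 = PI / 2.
Proof.
rewrite /wallis (RInt_ext _ (fun=> 1)) //.
by rewrite RInt_const /scal /= /mult /=; lra.
Qed.

Lemma wallis1 : wallis 1 = 1.
Proof.
have H : is_RInt (fun x => sin x ^ 1) 0 (PI / 2) (minus (- cos (PI / 2)) (- cos 0)).
  apply: (is_RInt_derive (fun x => - cos x)) => x _.
    by auto_derive => //; ring.
  by apply: ex_derive_continuous; auto_derive.
rewrite /wallis (is_RInt_unique _ _ _ _ H) cos_PI2 cos_0.
by rewrite /minus /plus /opp /=; ring.
Qed.

(** The derivative of [- cos x * sin x ^ n.+1] is [(n+2) sin^(n+2) - (n+1) sin^n], and this
    primitive vanishes at both 0 and [PI / 2]. *)
Lemma wallisSS n : INR n.+2 * wallis n.+2 = INR n.+1 * wallis n.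
Proof.
pose h x := - (cos x * sin x ^ n.+1).
pose dh x := INR n.+2 * sin x ^ n.+2 - INR n.+1 * sin x ^ n.
have H : is_RInt dh 0 (PI / 2) (minus (h (PI / 2)) (h 0)).
  apply: is_RInt_derive => x _; last by apply: ex_derive_continuous; rewrite /dh; auto_derive.
  rewrite /h /dh; auto_derive => //.
  have -> : match n with | 0%N => 1 | _.+1 => INR n + 1 end = INR n.+1 by [].
  rewrite (S_INR n.+1) -!tech_pow_Rmult.
  have := sin2_cos2 x; rewrite /Rsqr => E.
  have C : cos x * cos x = 1 - sin x * sin x by lra.
  transitivity (sin x * sin x * sin x ^ n - cos x * cos x * (INR n.+1 * sin x ^ n)).
    by ring.
  by rewrite C; ring.
have E := is_RInt_minus _ _ _ _ _ _
  (is_RInt_scal _ _ _ (INR n.+2) _ (RInt_correct _ _ _ (ex_RInt_sin_pow n.+2 0 (PI / 2))))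
  (is_RInt_scal _ _ _ (INR n.+1) _ (RInt_correct _ _ _ (ex_RInt_sin_pow n 0 (PI / 2)))).
have := is_RInt_unique _ _ _ _ E.
rewrite (is_RInt_unique dh _ _ _ H) -/(wallis n) -/(wallis n.+2).
rewrite /h cos_PI2 sin_0 /minus /plus /opp /scal /= /mult /=; lra.
Qed.

Lemma wallis_decr n : wallis n.+1 <= wallis n.
Proof.
have P0 := PI_RGT_0.
apply: RInt_le; first lra.
- exact: ex_RInt_sin_pow.
- exact: ex_RInt_sin_pow.
move=> x x0; have s0 : 0 <= sin x by apply: sin_ge_0; lra.
rewrite -[X in _ <= X]Rmult_1_l /=.
by apply: Rmult_le_compat_r (proj2 (SIN_bound x)); apply: pow_le.
Qed.

(** The Wallis recurrence and the functional equation of Gamma have the same factors, so the even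
    integrals are Gamma quotients up to the constant fixed at [k = 0]. *)
Lemma wallis_even k :
  wallis (2 * k) * gammah (2 * k).+2 = PI / 2 / gammah 1 * gammah (2 * k).+1.
Proof.
have g1 := gammah_gt0 0.
elim: k => [|k IH]; first by rewrite muln0 wallis0 gammah2; field; lra.
rewrite mulnS add2n !gammahSS; have n0 := pos_INR (2 * k).
have := wallisSS (2 * k); rewrite !S_INR => E.
have -> : wallis (2 * k).+2 * ((INR (2 * k) + 1 + 1) / 2 * gammah (2 * k).+2) =
  (INR (2 * k) + 1 + 1) * wallis (2 * k).+2 * (gammah (2 * k).+2 / 2) by field.
by rewrite E -[X in X = _]Rmult_1_r; transitivity ((INR (2 * k) + 1) / 2 * (wallis (2 * k) * gammah (2 * k).+2)); [field|rewrite IH; field; lra].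
Qed.

Lemma wallis_odd k :
  wallis (2 * k).+1 * gammah (2 * k).+3 = gammah 1 / 2 * gammah (2 * k).+2.
Proof.
elim: k => [|k IH]; first by rewrite muln0 wallis1 gammah2 gammahSS /=; field.
rewrite mulnS add2n gammahSS [gammah (2 * k).+4]gammahSS; have n0 := pos_INR (2 * k).
have := wallisSS (2 * k).+1; rewrite !S_INR => E.
have -> : wallis (2 * k).+3 * ((INR (2 * k) + 1 + 1 + 1) / 2 * gammah (2 * k).+3) =
  (INR (2 * k) + 1 + 1 + 1) * wallis (2 * k).+3 * (gammah (2 * k).+3 / 2) by field.
by rewrite E; transitivity ((INR (2 * k) + 1 + 1) / 2 * (wallis (2 * k).+1 * gammah (2 * k).+3)); [field|rewrite IH; field; lra].
Qed.

(** The integrals decrease, and their Gamma forms turn this into two inequalities between [PI] and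
    Gamma(1/2)^2 with error factors [r * r] tending to 1. *)
Lemma gammah1 : gammah 1 = sqrt PI.
Proof.
have g1 := gammah_gt0 0.
suff E : gammah 1 * gammah 1 = PI by rewrite -E sqrt_square; lra.
pose r j k := gammah (2 * k + j).+2 /
    (sqrt (INR (2 * k + j).+1 / 2) * gammah (2 * k + j).+1).
have rE j k : gammah (2 * k + j).+2 = r j k * sqrt (INR (2 * k + j).+1 / 2) * gammah (2 * k + j).+1
  /\ sqrt (INR (2 * k + j).+1 / 2) * sqrt (INR (2 * k + j).+1 / 2) = INR (2 * k + j).+1 / 2
  /\ 0 < sqrt (INR (2 * k + j).+1 / 2).
  have n0 : 0 < INR (2 * k + j).+1 / 2 by rewrite S_INR; have := pos_INR (2 * k + j); lra.
  have s0 := sqrt_lt_R0 _ n0; have g := gammah_gt0 (2 * k + j).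
  split; first by rewrite /r; field; lra.
  by split=> //; apply: sqrt_sqrt; lra.
have r0 j k : 0 < r j k.
  have [_ [_ s0]] := rE j k.
  apply: Rdiv_lt_0_compat; first exact: gammah_gt0.
  by apply: Rmult_lt_0_compat => //; apply: gammah_gt0.
(* This is W(2k+2) <= W(2k+1), with the even integral carrying [PI] and the odd one [gammah 1]. *)
have lower k : PI * (r 1%N k * r 1%N k) <= gammah 1 * gammah 1.
  have := rE 1%N k; move: (r0 1%N k) (wallis_decr (2 * k).+1) (wallis_odd k).
  have := wallis_even k.+1; rewrite mulnS add2n [gammah _.+4]gammahSS addn1.
  move: (gammah_gt0 (2 * k).+1) (gammah_gt0 (2 * k).+2).
  move: (gammah (2 * k).+2) (gammah (2 * k).+3) (wallis (2 * k).+2)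
    (wallis (2 * k).+1) (r 1%N k).
  move: (INR _ / 2) (sqrt _) => q S x y w2 w1 t x0 y0 Ev t0 D Od [E1 [E2 S0]].
  rewrite E1 -E2 in Ev; rewrite E1 in Od.
  have w2E : w2 = PI * t / (2 * gammah 1 * S).
    apply: (Rmult_eq_reg_r (S * S * x)); last by nra.
    by rewrite Ev; field; lra.
  have w1E : w1 = gammah 1 / (2 * t * S).
    apply: (Rmult_eq_reg_r (t * S * x)); last by nra.
    by rewrite Od; field; lra.
  have c0 : 0 < 2 * gammah 1 * S * t by repeat apply: Rmult_lt_0_compat; lra.
  apply: (Rmult_le_reg_r (/ (2 * gammah 1 * S * t))); first exact: Rinv_0_lt_compat.
  rewrite (_ : PI * _ * _ = w2); last by rewrite w2E; field; lra.
  by rewrite (_ : gammah 1 * _ * _ = w1) //; rewrite w1E; field; lra.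
(* This is W(2k+1) <= W(2k), which gives the opposite inequality. *)
have upper k : (gammah 1 * gammah 1) * (r 0%N k * r 0%N k) <= PI.
  have := rE 0%N k; move: (r0 0%N k) (wallis_decr (2 * k)) (wallis_odd k).
  have := wallis_even k; rewrite addn0 [gammah _.+3]gammahSS.
  move: (gammah_gt0 (2 * k)) (gammah_gt0 (2 * k).+1).
  move: (gammah (2 * k).+1) (gammah (2 * k).+2) (wallis (2 * k))
    (wallis (2 * k).+1) (r 0%N k).
  move: (INR _ / 2) (sqrt _) => q S x y w1 w2 t x0 y0 Ev t0 D Od [E1 [E2 S0]].
  rewrite E1 in Ev; rewrite E1 -E2 in Od.
  have w1E : w1 = PI / (2 * gammah 1 * t * S).
    apply: (Rmult_eq_reg_r (t * S * x)); last by nra.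
    by rewrite Ev; field; lra.
  have w2E : w2 = gammah 1 * t / (2 * S).
    apply: (Rmult_eq_reg_r (S * S * x)); last by nra.
    by rewrite Od; field; lra.
  have c0 : 0 < 2 * gammah 1 * S * t by repeat apply: Rmult_lt_0_compat; lra.
  apply: (Rmult_le_reg_r (/ (2 * gammah 1 * S * t))); first exact: Rinv_0_lt_compat.
  rewrite (_ : PI * _ = w1); last by rewrite w1E; field; lra.
  by rewrite (_ : gammah 1 * _ * _ * _ = w2) //; rewrite w2E; field; lra.
have L j : is_lim_seq (fun k => r j k * r j k) 1.
  rewrite (_ : 1 = 1 * 1); last by ring.
  by apply: is_lim_seq_mult'; apply: gammah_ratio.
apply: Rle_antisym.
  have H := is_lim_seq_scal_l _ (gammah 1 * gammah 1) _ (L 0%N).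
  rewrite -(Rmult_1_r (gammah 1 * gammah 1)).
  exact: (is_lim_seq_le _ _ _ _ upper H (is_lim_seq_const PI)).
have H := is_lim_seq_scal_l _ PI _ (L 1%N).
rewrite -{1}(Rmult_1_r PI).
exact: (is_lim_seq_le _ _ _ _ lower H (is_lim_seq_const _)).
Qed.
End Wallis.

(** * Asymptotics of the Catalan numbers *)

Section CatalanAsymptotics.
Local Open Scope R_scope.

(** In the application [p] is the coefficient sequence of 1/D and [f] the Catalan numbers. The extra
    factor [2 * (2 * k + 1)] accounts for the exponent 3 under the root. *)
Lemma asymp_catalan (p : nat -> R) (f : nat -> nat) :
  is_lim_seq (fun k => p k.+1 / 4 ^ k.+1 * sqrt (INR k.+1)) (/ sqrt PI) ->
  (forall k, 2 * (2 * INR k + 1) * INR (f k) = p k.+1) ->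
  is_lim_seq (fun k => INR (f k) /
    (sqrt 2 * 2 ^ (2 * k + 1) / sqrt (PI * INR (2 * k + 1) ^ 3))) 1.
Proof.
move=> pl fE; have P0 := PI_RGT_0; have s0 := sqrt_lt_R0 _ P0.
have H := is_lim_seq_mult' _ _ _ _ (is_lim_seq_mult' _ _ _ _ pl
  (is_lim_seq_const (sqrt PI))) (is_lim_seq_sqrt_ratio 1 2 (c := 2) Rlt_0_2).
rewrite Rinv_l ?Rmult_1_l in H; last by lra.
apply: is_lim_seq_ext H => k; have k0 := pos_INR k.
have e1 : (INR (2 * k + 1) = 2 * INR k + 1) by rewrite plus_INR mult_INR /=; lra.
have e2 : INR k.+1 = ((2 * INR k + 2) / 2) by rewrite S_INR; lra.
rewrite -fE e1 e2; set n := (2 * INR k + 1); set n1 := (2 * INR k + 2).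
have n0 : (0 < n) by rewrite /n; lra.
have n10 : (0 < n1) by rewrite /n1; lra.
have -> : (4 ^ k.+1 = 2 * 2 ^ (2 * k + 1)).
  rewrite addn1 tech_pow_Rmult (_ : (2 * k).+2 = (2 * k.+1)%N); last by rewrite mulnS.
  by rewrite -multE pow_mult (_ : 2 ^ 2 = 4) //=; lra.
have -> : (PI * n ^ 3 = PI * (n * (n * n))) by ring.
rewrite (sqrt_mult_alt PI) ?(sqrt_mult_alt n (n * n)) ?sqrt_square; try lra.
rewrite !sqrt_div_alt; try lra.
have p2 : (0 < 2 ^ (2 * k + 1)) by apply: pow_lt; lra.
have q2 : (0 < sqrt 2) by apply: sqrt_lt_R0; lra.
have q1 := sqrt_lt_R0 _ n10; have q0 := sqrt_lt_R0 _ n0.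
have q22 : (sqrt 2 * sqrt 2 = 2) by apply: sqrt_sqrt; lra.
by field; lra.
Qed.
End CatalanAsymptotics.

(** * Embeddings as subsequences of the preorder *)

Lemma ptree_nested_ind (P : ptree -> Prop) :
  (forall ts, List.Forall P ts -> P (PNode ts)) -> forall t, P t.
Proof.
move=> IH; fix rec 1 => -[ts]; apply: IH.
by elim: ts => [|t ts IHts]; constructor.
Qed.

Definition crel (v w : seq nat) : bool * bool := (prefix v w, leftof v w).

(** Each row relates a word to the later ones only. For words in preorder this is enough: a later
    word is neither an ancestor nor to the left of an earlier one. *)
Fixpoint cmat (s : seq (seq nat)) : seq (seq (bool * bool)) :=
  if s is x :: s' then map (crel x) s' :: cmat s' else [::].

(* The matrix [cmat] of a concatenation whose first part is left of the second. *)
Definition jn (M N : seq (seq (bool * bool))) :=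
  [seq r ++ nseq (size N) (false, true) | r <- M] ++ N.

Fixpoint tm (t : ptree) : seq (seq (bool * bool)) :=
  let: PNode ts := t in
  let f := foldr jn [::] (map tm ts) in nseq (size f) (true, false) :: f.

Definition fm (ts : seq ptree) := foldr jn [::] (map tm ts).

Lemma size_cmat s : size (cmat s) = size s.
Proof. by elim: s => //= x s ->. Qed.

Lemma crel_cons a v w : crel (a :: v) (a :: w) = crel v w.
Proof. by rewrite /crel /= eqxx ltnn. Qed.

Lemma cmat_cons a s : cmat (map (cons a) s) = cmat s.
Proof.
elim: s => //= x s ->; rewrite -map_comp; congr (_ :: _).
by apply: eq_map => y /=; rewrite crel_cons.
Qed.

Lemma cmat_root s : cmat ([::] :: s) = nseq (size s) (true, false) :: cmat s.
Proof.
by congr (_ :: _); elim: s => //= x s ->; rewrite /crel /= prefix0s.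
Qed.

Lemma cmat_cat s t :
  {in s & t, forall v w, crel v w = (false, true)} ->
  cmat (s ++ t) = jn (cmat s) (cmat t).
Proof.
rewrite /jn size_cmat; elim: s => //= x s IHs st.
rewrite IHs; last by move=> v w vs; apply: st; rewrite inE vs orbT.
congr (_ :: _); rewrite map_cat; congr (_ ++ _).
have: {in t, forall w, crel x w = (false, true)}.
  by move=> w; apply: st; rewrite mem_head.
elim: t {IHs st} => //= y t IHt xt; rewrite (xt y) ?mem_head // IHt // => w wt.
by apply: xt; rewrite inE wt orbT.
Qed.

(** The offset [a] is the index given to the first tree; induction on the list of children shifts
    it. *)
Definition fverts a (ts : seq ptree) :=
  flatten [seq map (cons p.1) p.2 | p <- zip (iota a (size ts)) (map verts ts)].

Lemma vertsE ts : verts (PNode ts) = [::] :: fverts 0 ts.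
Proof. by []. Qed.

Lemma fverts_cons a t ts :
  fverts a (t :: ts) = map (cons a) (verts t) ++ fverts a.+1 ts.
Proof. by []. Qed.

Lemma fvertsP a ts w : w \in fverts a ts -> exists b w', a <= b /\ w = b :: w'.
Proof.
elim: ts a => [|t ts IHts] a; first by [].
rewrite fverts_cons mem_cat => /orP[/mapP[w' _ ->]|/IHts[b [w' [ab ->]]]].
  by exists a, w'.
by exists b, w'; split=> //; apply: ltnW.
Qed.

Lemma crel_left a b v w : a < b -> crel (a :: v) (b :: w) = (false, true).
Proof. by move=> ab; rewrite /crel /= ab (ltn_eqF ab). Qed.

Lemma cmat_verts t : cmat (verts t) = tm t.
Proof.
elim/ptree_nested_ind: t => ts IH; rewrite vertsE cmat_root /= -/(fm ts).
suff E a : cmat (fverts a ts) = fm ts by rewrite -(E 0) size_cmat.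
elim: IH a => [|t {}ts tE _ IHts] a //.
rewrite fverts_cons cmat_cat ?cmat_cons ?tE ?IHts // => v w.
move=> /mapP[v' _ ->] /fvertsP[b [w' [ab ->]]]; exact: crel_left.
Qed.

(** * Unique decomposition of relation matrices under joins *)

Lemma jn0m M : jn [::] M = M. Proof. by []. Qed.

Lemma jnm0 M : jn M [::] = M.
Proof. by rewrite /jn cats0 -[RHS]map_id; apply: eq_map => r; rewrite cats0. Qed.

Lemma size_jn M N : size (jn M N) = size M + size N.
Proof. by rewrite size_cat size_map. Qed.

Lemma jnA : associative jn.
Proof.
move=> M N P; rewrite /jn map_cat -catA; congr (_ ++ _).
rewrite -map_comp; apply: eq_map => r /=.
by rewrite -catA -nseqD size_cat size_map.
Qed.

Lemma cat_cancelr (T : eqType) (s1 s2 t : seq T) : s1 ++ t = s2 ++ t -> s1 = s2.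
Proof.
move=> E; have /addIn sz: size s1 + size t = size s2 + size t.
  by rewrite -!size_cat E.
by move/eqP: E; rewrite eqseq_cat // => /andP[/eqP].
Qed.

(** The analogue of Levi's lemma for words. The leading rows of [A] must end with the constant
    entries coming from the join on the other side, and cancelling the part due to [B] exhibits [A]
    as a join. *)
Lemma jn_levi A B M N : size M <= size A -> jn A B = jn M N ->
  exists X, A = jn M X /\ N = jn X B.
Proof.
move=> MA; rewrite /jn -{1}[A](cat_take_drop (size M)) map_cat -catA => /eqP.
rewrite eqseq_cat ?size_map ?size_takel // => /andP[/eqP E1 /eqP E2].
exists (drop (size M) A); split; last by rewrite -E2.
rewrite -{1}[A](cat_take_drop (size M)); congr (_ ++ _).
move: E1; rewrite -E2 size_cat size_map nseqD.
move: (size_takel MA); clear E2 MA.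
move: (take _ _) (drop _ _) => A1 X.
elim: A1 M => [|a A1 IH] [|b M] //= [sz] [].
by rewrite catA => /cat_cancelr-> /IH ->; rewrite ?sz.
Qed.

Lemma jn_inj M N N' : size N = size N' -> jn M N = jn M N' -> N = N'.
Proof.
by move=> sz /eqP; rewrite /jn sz eqseq_cat ?size_map // => /andP[_ /eqP].
Qed.

Lemma jn_cancel M N N' : jn M N = jn M N' -> N = N'.
Proof.
move=> E; apply: jn_inj (E).
by have := congr1 size E; rewrite !size_jn => /addnI.
Qed.

Lemma jn_eq2 M N N' : (jn M N == jn M N') = (N == N').
Proof. by apply/eqP/eqP => [/jn_cancel|->]. Qed.

(** A tree matrix cannot be cut: if a nonempty [A] ended inside [tm t], the root row would need the
    entry [(false, true)] where the root is an ancestor. Hence [A] covers [tm t] and [jn_levi]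
    applies. *)
Lemma jn_split A B t N : jn A B = jn (tm t) N ->
  A = [::] \/ exists X, A = jn (tm t) X /\ N = jn X B.
Proof.
case: A => [|r A] E; [by left|right; apply: jn_levi (E)].
move: (congr1 size E); rewrite !size_jn.
case: t E => ts; rewrite /= -/(fm ts); set f := fm ts => -[row _].
rewrite !addSn => -[sz].
rewrite leqNgt ltnS; apply/negP => Af.
have rA : size r = size A.
  move: (congr1 size row); rewrite !size_cat !size_nseq -sz.
  by move/addIn.
move: (congr1 (fun s => nth (false, true) s (size A)) row).
by rewrite !nth_cat size_nseq Af !nth_nseq Af rA ltnn; case: ifP.
Qed.

Lemma fm0 : fm [::] = [::]. Proof. by []. Qed.

Lemma fm_cons t ts : fm (t :: ts) = jn (tm t) (fm ts).
Proof. by []. Qed.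

Lemma size_tm_gt0 t : 0 < size (tm t).
Proof. by case: t. Qed.

Lemma fm_eq0 ts : (fm ts == [::]) = nilp ts.
Proof.
by case: ts => // t ts; rewrite -size_eq0 fm_cons size_jn -leqn0 leqNgt addn_gt0 size_tm_gt0.
Qed.

Lemma fm1 t : fm [:: t] = tm t.
Proof. by rewrite fm_cons jnm0. Qed.

(** A join is the matrix of a forest for exactly one cut of the forest. The boolean is written as a
    sum over cuts so that it can be summed over all pairs of subsequences; the proof peels off the
    first tree. *)
Lemma jn_fm A B ts :
  (jn A B == fm ts) =
  \sum_(i < (size ts).+1) ((A == fm (take i ts)) && (B == fm (drop i ts))) :> nat.
Proof.
elim: ts A => [|t ts IHts] A.
  rewrite big_ord_recl big_ord0 addn0 /=.
  by case: A => [|r A] //; case: B.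
rewrite big_ord_recl take0 drop0 fm0.
have [->|A0] := eqVneq A [::].
  rewrite jn0m big1 ?addn0 // => i _ /=.
  by rewrite eq_sym fm_eq0.
rewrite add0n.
(* Only suffixes of [A] can remain after [tm t], since the rows coming from [tm t] stand first. *)
have [|AB] := boolP [exists i : 'I_(size A).+1, A == jn (tm t) (drop i A)].
  move=> /existsP[i /eqP]; move: (drop i A) => X ->.
  rewrite -jnA fm_cons jn_eq2 IHts; apply: eq_bigr => j _.
  by rewrite /= fm_cons jn_eq2.
have AN X : A <> jn (tm t) X.
  move=> AE; case/negP: AB; apply/existsP.
  have sA : size (tm t) < (size A).+1 by rewrite AE size_jn ltnS leq_addr.
  exists (Ordinal sA); rewrite /= {1}AE; apply/eqP; congr jn.
  by rewrite AE /jn drop_size_cat ?size_map.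
rewrite big1 => [|j _]; last first.
  by rewrite /= fm_cons; case: eqP => // /AN.
by case: eqP => // /jn_split[/eqP|[X [/AN]]] //; rewrite (negbTE A0).
Qed.

(** * Subsequences of a list and subsets of a finite type *)

Section Subseqs.
Variable T : Type.

Fixpoint subseqs (s : seq T) : seq (seq T) :=
  if s is x :: s' then map (cons x) (subseqs s') ++ subseqs s' else [:: [::]].

Lemma subseqs_cat s t :
  subseqs (s ++ t) = [seq x ++ y | x <- subseqs s, y <- subseqs t].
Proof.
elim: s => [|x s IHs] /=; first by rewrite cats0 map_id.
by rewrite IHs allpairs_cat map_allpairs allpairs_mapl.
Qed.
End Subseqs.

Lemma subseqs_map (T U : Type) (f : T -> U) s :
  subseqs (map f s) = map (map f) (subseqs s).
Proof.
elim: s => //= x s ->; rewrite map_cat -!map_comp.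
by congr (_ ++ _).
Qed.

Lemma mem_subseqs (T : eqType) (s t : seq T) : (s \in subseqs t) = subseq s t.
Proof.
elim: t s => [|y t IHt] s; first by case: s.
rewrite /= mem_cat IHt; case: s => [|x s]; first by rewrite sub0seq orbT.
rewrite [RHS]/=; case: eqVneq => [<-|xy].
  rewrite mem_map ?IHt; last by move=> ? ? [].
  by apply/orb_idr => /cons_subseq.
by case: mapP => //= -[z _ [/eqP]]; rewrite (negbTE xy).
Qed.

Lemma subseqs_uniq (T : eqType) (t : seq T) : uniq t -> uniq (subseqs t).
Proof.
elim: t => //= y t IHt /andP[yt /IHt ut].
rewrite cat_uniq ut map_inj_uniq ?ut; last by move=> ? ? [].
rewrite andbT; apply/hasPn => s; rewrite mem_subseqs => st.
by apply/mapP => -[s' _ sE]; move: (mem_subseq st); rewrite sE => /(_ y (mem_head _ _)); apply/negP.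
Qed.

(** Listing a subset in enumeration order is a bijection from subsets onto subsequences of the
    enumeration. *)
Lemma card_set_count (I : finType) (P : pred (seq I)) :
  #|[set E : {set I} | P (enum E)]| = count P (subseqs (enum I)).
Proof.
have -> : #|[set E : {set I} | P (enum E)]| = count P [seq enum E | E : {set I}].
  rewrite cardsE cardE size_filter /image_mem count_map.
  rewrite enumT; exact: eq_count.
apply/permP/uniq_perm.
- by rewrite map_inj_uniq ?enum_uniq // => A B AB; apply/setP => x; rewrite -mem_enum AB mem_enum.
- exact/subseqs_uniq/enum_uniq.
move=> s; rewrite mem_subseqs; apply/mapP/idP => [[E _ ->]|].
  by rewrite {1}/enum_mem enumT filter_subseq.
move=> s_sub; exists [set x in s]; first by rewrite mem_enum.
rewrite {1}(subseq_uniqP (enum_uniq I) s_sub) {2}/enum_mem -enumT.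
by apply: eq_filter => x; rewrite !inE.
Qed.

(** * The preorder on vertices *)

Definition plt (v w : seq nat) := (prefix v w && (v != w)) || leftof v w.

(** So [plt] is the lexicographic order on words, with a proper prefix coming first. *)
Lemma plt_cons a b v w : plt (a :: v) (b :: w) = (a < b) || (a == b) && plt v w.
Proof.
rewrite /plt /= eqseq_cons.
by case: (ltngtP a b) => //= _; rewrite ?orbT.
Qed.

Lemma plt0 w : plt [::] w = (w != [::]).
Proof. by rewrite /plt prefix0s orbF eq_sym. Qed.

Lemma plts0 w : plt w [::] = false.
Proof. by case: w. Qed.

Lemma plt_irr : irreflexive plt.
Proof. by elim=> [|a v IH]; rewrite ?plt0 // plt_cons ltnn eqxx IH. Qed.

Lemma plt_trans : transitive plt.
Proof.
elim=> [|b v IH] [|a u] [|c w] //; rewrite ?plt0 ?plts0 // !plt_cons.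
case: (ltngtP a b) => [ab|ba|->] //=.
  by case: (ltngtP b c) => [bc|cb|<-] //=; rewrite ?ab // (ltn_trans ab bc).
by case: (ltngtP b c) => //= _; apply: IH.
Qed.

Lemma plt_asym v w : plt v w -> plt w v = false.
Proof. by move=> vw; apply/negP => /(plt_trans vw); rewrite plt_irr. Qed.

Lemma leftofN_prefix v w : leftof v w -> prefix v w = false.
Proof.
elim: v w => [|a v IH] [|b w] //=.
by case: (ltngtP a b) => //= _ /IH.
Qed.

Lemma leftof_prefix v w v' w' :
  leftof v w -> prefix v v' -> prefix w w' -> leftof v' w'.
Proof.
elim: v w v' w' => [|a v IH] [|b w] [|a' v'] [|b' w'] //=.
move=> + /andP[/eqP<- vv] /andP[/eqP<- ww].
by case: (ltngtP a b) => //= _ /IH; apply.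
Qed.

Lemma leftof_split v w : leftof v w ->
  exists p a b v' w', [/\ a < b, v = p ++ a :: v' & w = p ++ b :: w'].
Proof.
elim: v w => [|a v IH] [|b w] //= /orP[ab|/andP[/eqP<- /IH]].
  by exists [::], a, b, v, w.
move=> [p [c [d [v' [w' [cd -> ->]]]]]].
by exists (a :: p), c, d, v', w'.
Qed.

(** Between words in preorder the two relations are complementary, so a map that respects the
    preorder and ancestry also respects left-of. *)
Lemma plt_leftof v w : plt v w -> leftof v w = ~~ prefix v w.
Proof.
rewrite /plt; case: (boolP (leftof v w)) => [/leftofN_prefix->//|_].
by rewrite orbF => /andP[->].
Qed.

Lemma plt_prefixN v w : plt v w -> prefix w v = false.
Proof.
move=> vw; apply/negbTE/negP => wv; move: (plt_asym vw).
by rewrite /plt wv /=; case: eqP => // wE; rewrite wE plt_irr in vw.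
Qed.

Lemma pairwise_verts t : pairwise plt (verts t).
Proof.
elim/ptree_nested_ind: t => ts IH; rewrite vertsE pairwise_cons.
apply/andP; split.
  by apply/allP => w /fvertsP[b [w' [_ ->]]].
elim: IH 0 => [|t {}ts tP _ IHts] a //.
rewrite fverts_cons pairwise_cat IHts andbT; apply/andP; split.
  apply/allrelP => v w /mapP[v' _ ->] /fvertsP[b [w' [ab ->]]].
  by rewrite plt_cons ab.
by elim: (verts t) tP => //= v s IHs /andP[vs /IHs->]; rewrite andbT all_map; apply: sub_all vs => w; rewrite /= plt_cons eqxx => ->; rewrite orbT.
Qed.

Lemma verts_uniq t : uniq (verts t).
Proof. exact/(pairwise_uniq plt_irr)/pairwise_verts. Qed.

Lemma verts_prefix t v w : v ++ w \in verts t -> v \in verts t.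
Proof.
elim/ptree_nested_ind: t v => ts IH v; rewrite vertsE !inE.
case: v => // b v /=.
elim: IH 0 => [|t {}ts tP _ IHts] a //.
rewrite fverts_cons !mem_cat => /orP[|/IHts->]; last by rewrite orbT.
by case/mapP => u ut [-> uE]; rewrite map_f //; apply: tP; rewrite uE.
Qed.

Lemma cmatP s t : reflect
  (size s = size t /\ forall i j, i < j < size s ->
     crel (nth [::] s i) (nth [::] s j) = crel (nth [::] t i) (nth [::] t j))
  (cmat s == cmat t).
Proof.
elim: s t => [|x s IHs] [|y t]; do ?[by constructor; case].
- by apply: ReflectT; split => // i j; rewrite ltn0 andbF.
rewrite /= eqseq_cons; apply: (iffP andP) => [[/eqP E /IHs[sz st]]|[[sz] st]].
  split=> [|[|i] [|j]]; rewrite ?sz //=; last first.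
    by rewrite !ltnS => ij; apply: st; rewrite sz.
  rewrite ltnS => js; have := congr1 (nth (true, true) ^~ j) E.
  by rewrite !(nth_map [::]) ?sz.
split; last by apply/IHs; split=> // i j ij; apply: (st i.+1 j.+1).
apply/eqP/(@eq_from_nth _ (true, true)); rewrite ?size_map // => j js.
rewrite !(nth_map [::]) -?sz //; exact: (st 0 j.+1).
Qed.

(** * Translation of embeddings into subsequences *)

Lemma ord_enum_sorted n : sorted [rel i j : 'I_n | i < j] (enum 'I_n).
Proof.
have := iota_ltn_sorted 0 n.
by rewrite -val_enum_ord sorted_map.
Qed.

Lemma enum_set_sorted n (E : {set 'I_n}) : sorted [rel i j : 'I_n | i < j] (enum E).
Proof.
rewrite /(enum E) /enum_mem -enumT sorted_filter ?ord_enum_sorted //.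
by move=> i j k; apply: ltn_trans.
Qed.

Lemma map_vert_enum t : [seq tvert j | j <- enum 'I_(size (verts t))] = verts t.
Proof.
apply: (@eq_from_nth _ [::]); rewrite size_map size_enum_ord // => i ilt.
by rewrite (nth_map (Ordinal ilt)) ?size_enum_ord // /tvert nth_enum_ord.
Qed.

Lemma plt_tvert t (i j : 'I_(size (verts t))) : plt (tvert i) (tvert j) = (i < j).
Proof.
have /(pairwiseP [::]) vP := pairwise_verts t.
case: (ltngtP i j) => ij; first by rewrite /tvert vP ?inE.
  by rewrite plt_asym // /tvert vP ?inE.
by rewrite /tvert ij plt_irr.
Qed.

(** An embedding is only required to respect the order of siblings. The two children of the lowest
    common ancestor carry that requirement to every pair related by left-of. *)
Lemma leftof_ancestors t (i j : 'I_(size (verts t))) : leftof (tvert i) (tvert j) ->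
  exists i' j' : 'I_(size (verts t)),
    [/\ prefix (tvert i') (tvert i), prefix (tvert j') (tvert j) &
        sib_before (tvert i') (tvert j')].
Proof.
move=> /leftof_split[p [a [b [v [w [ab iE jE]]]]]].
have wit c u (k : 'I_(size (verts t))) : tvert k = p ++ c :: u ->
    exists k' : 'I_(size (verts t)), tvert k' = rcons p c.
  move=> kE; have : rcons p c \in verts t.
    by apply: (@verts_prefix _ _ u); rewrite cat_rcons -kE mem_nth.
  by move=> /(nthP [::])[k' k'lt <-]; exists (Ordinal k'lt).
have [i' i'E] := wit _ _ _ iE; have [j' j'E] := wit _ _ _ jE.
exists i', j'; rewrite i'E j'E iE jE -!cat_rcons !prefix_prefix /sib_before.
by rewrite !size_rcons !last_rcons -!cats1 !take_size_cat // ab !eqxx.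
Qed.

(** An isomorphism [phi] is increasing in preorder, so it lists [E] in order and preserves the
    matrix. Conversely, if the matrices agree, sending the i-th vertex of [S] to the i-th element of
    [E] is the isomorphism. *)
Lemma is_embeddingE S T (E : {set 'I_(size (verts T))}) :
  is_embedding S E = (cmat [seq tvert j | j <- enum E] == tm S).
Proof.
rewrite -cmat_verts.
apply/existsP/idP => [[phi /and4P[/injectiveP inj /eqP imE le sib]]|].
  have {}le i j : prefix (tvert i) (tvert j) = prefix (tvert (phi i)) (tvert (phi j)).
    exact/eqP/(forallP (forallP le j)).
  have {}sib i j : sib_before (tvert i) (tvert j) ->
      leftof (tvert (phi i)) (tvert (phi j)).
    exact/implyP/(forallP (forallP sib i)).
  have lt_phi (i j : 'I_(size (verts S))) : i < j -> phi i < phi j.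
    rewrite -!plt_tvert {1}/plt => /orP[/andP[ij nij]|].
      rewrite /plt -le ij orbC; case: (leftof _ _) => //=.
      apply/eqP => E'; case/eqP: nij; suff -> : i = j by [].
      apply: inj; apply: val_inj; apply/eqP.
      by rewrite -(nth_uniq [::] _ _ (verts_uniq T)) ?ltn_ord //; exact/eqP.
    case/leftof_ancestors=> i' [j' [i'i j'j /sib ll]].
    by rewrite /plt (leftof_prefix ll) ?orbT // -le.
  have -> : enum E = map phi (enum 'I_(size (verts S))).
    apply: (@irr_sorted_eq _ [rel i j : 'I_(size (verts T)) | i < j]).
    - by move=> i j k; apply: ltn_trans.
    - by move=> i; apply: ltnn.
    - exact: enum_set_sorted.
    - rewrite sorted_map; apply: sub_sorted (ord_enum_sorted _) => i j.
      exact: lt_phi.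
    move=> i; rewrite mem_enum -imE; apply/imsetP/mapP => [[x _ ->]|[x _ ->]].
      by exists x; rewrite ?mem_enum.
    by exists x.
  rewrite -[X in _ == cmat X]map_vert_enum -map_comp.
  apply/cmatP; split=> [|i j /andP[ij]]; first by rewrite !size_map.
  rewrite !size_map -enumT -cardT card_ord => jlt.
  have ilt := ltn_trans ij jlt.
  rewrite !(nth_map (Ordinal ilt)) -?enumT ?size_enum_ord //=.
  rewrite -?enumT; set i' := nth _ _ i; set j' := nth _ _ j.
  have ij' : i' < j' by rewrite /i' /j' !nth_enum_ord.
  by rewrite /crel !plt_leftof ?plt_tvert ?lt_phi // -le.
move=> /cmatP[]; rewrite size_map => sz rel.
have szE (i : 'I_(size (verts S))) : i < size (enum E) by rewrite sz.
(* A default vertex for [nth], available because a tree has a root; [E] has as many elements as [S]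
   has vertices, so the default is never returned. *)
have kT : size (verts T) = (size (verts T)).-1.+1 by case: (T).
pose x0 : 'I_(size (verts T)) := cast_ord (esym kT) ord0.
pose phi := [ffun i : 'I_(size (verts S)) => nth x0 (enum E) i].
have rel' (i j : 'I_(size (verts S))) : i < j ->
    crel (tvert (phi i)) (tvert (phi j)) = crel (tvert i) (tvert j).
  move=> ij; rewrite !ffunE -rel ?ij ?sz //=.
  by rewrite !(nth_map x0) ?szE.
have lt_phi (i j : 'I_(size (verts S))) : i < j -> phi i < phi j.
  move=> ij; rewrite !ffunE.
  have := enum_set_sorted E; rewrite sorted_pairwise; last first.
    by move=> a b c; apply: ltn_trans.
  by move/(pairwiseP x0); apply; rewrite ?inE ?szE.
exists phi; apply/and4P; split.
- apply/injectiveP => i j E'; apply/val_inj.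
  by case: (ltngtP i j) => // /lt_phi; rewrite E' ltnn.
- apply/eqP/setP => x; rewrite -[RHS]mem_enum; apply/imsetP/idP => [[i _ ->]|].
    by rewrite ffunE mem_nth.
  move=> xE; have xlt : index x (enum E) < size (verts S) by rewrite -sz index_mem.
  by exists (Ordinal xlt); rewrite // ffunE nth_index.
- apply/forallP => i; apply/forallP => j; apply/eqP; rewrite /tle -!/(tvert _).
  case: (ltngtP i j) => ij.
  + rewrite !plt_prefixN ?plt_tvert ?lt_phi //.
  + by case: (rel' _ _ ij).
  by rewrite (val_inj ij) !prefix_refl.
apply/forallP => i; apply/forallP => j; apply/implyP => sb.
have lij : leftof (tvert i) (tvert j).
  case/and4P: sb; rewrite /svert -!/(tvert _); move: (tvert i) (tvert j) => v w.
  case/lastP: v => // v a; case/lastP: w => // w b _.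
  rewrite !size_rcons => /eqP[vw]; rewrite -vw !last_rcons -!cats1.
  rewrite {1}vw !take_size_cat // => /eqP->.
  by elim: w {vw} => [|c w IH] /= ab; rewrite ?ab ?eqxx ?IH ?orbT.
have ij : i < j by rewrite -plt_tvert /plt lij orbT.
by case: (rel' _ _ ij) => _ ->.
Qed.

Lemma count_tvert T (P : pred (seq (seq nat))) :
  #|[set E : {set 'I_(size (verts T))} | P [seq tvert j | j <- enum E]]| =
  count P (subseqs (verts T)).
Proof.
rewrite (card_set_count (fun s => P (map (@tvert T) s))).
by rewrite -[in RHS](map_vert_enum T) subseqs_map count_map.
Qed.

Lemma n_embE S T :
  n_emb S T = count (fun es => cmat es == tm S) (subseqs (verts T)).
Proof.
rewrite -count_tvert; apply: eq_card => E.
by rewrite !inE is_embeddingE.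
Qed.

Lemma n_good_embE S T :
  n_good_emb S T =
  count (fun es => (cmat es == tm S) && ([::] \in es)) (subseqs (verts T)).
Proof.
rewrite -count_tvert; apply: eq_card => E.
rewrite !inE /is_good_embedding is_embeddingE; congr (_ && _).
apply/existsP/mapP => [[j /andP[jE /eqP j0]]|[j jE j0]].
  by exists j; rewrite ?mem_enum.
by exists j; rewrite -j0 eqxx -mem_enum jE.
Qed.

(** * Splitting at the root of a binary tree *)

Lemma cmat_root_fm s ts :
  (cmat ([::] :: s) == fm ts) =
  if ts is [:: PNode cs] then cmat s == fm cs else false.
Proof.
rewrite cmat_root; case: ts => [|[cs] [|t ts]] //.
  rewrite fm1 /= -/(fm cs) eqseq_cons -(size_cmat s).
  by apply/andP/idP => [[]|/eqP->].
(* With two or more trees the first row contains [(false, true)], whereas the row of a root contains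
   only [(true, false)]. *)
rewrite fm_cons /= eqseq_cons; apply/negbTE; rewrite negb_and; apply/orP; left.
have: 0 < size (fm (t :: ts)) by rewrite lt0n size_eq0 fm_eq0.
case: (size (fm _)) => // n _; apply/eqP => /(congr1 (fun s => (false, true) \in s)).
by rewrite mem_cat !mem_nseq /= orbT !andbF.
Qed.

(** The empty forest has exactly one occurrence, the empty subsequence, so its total over all trees
    counts the trees themselves. *)
Definition nfor (ts : seq ptree) (t : btree) : nat :=
  count (fun es => cmat es == fm ts) (subseqs (verts (bt2pt t))).

Definition ngood (s : ptree) (t : btree) : nat :=
  count (fun es => (cmat es == tm s) && ([::] \in es))
    (subseqs (verts (bt2pt t))).

Definition nsplit (ts : seq ptree) (l r : btree) : nat :=
  \sum_(i < (size ts).+1) nfor (take i ts) l * nfor (drop i ts) r.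

Definition subwords (l r : btree) : seq (seq nat) :=
  map (cons 0) (verts (bt2pt l)) ++ map (cons 1) (verts (bt2pt r)).

(** A subsequence of the concatenation is a pair of subsequences whose matrices are joined, and
    [jn_fm] attributes each match to one cut of the forest. *)
Lemma count_split ts l r :
  count (fun es => cmat es == fm ts) (subseqs (subwords l r)) = nsplit ts l r.
Proof.
rewrite subseqs_cat !subseqs_map -sum1_count big_mkcond big_allpairs_dep big_map.
under eq_bigr => x _.
  rewrite big_map; under eq_bigr => y _.
    rewrite (_ : cmat _ = jn (cmat x) (cmat y)); last first.
      rewrite cmat_cat ?cmat_cons // => v w /mapP[v' _ ->] /mapP[w' _ ->].
      exact: crel_left.
    rewrite -[if _ then _ else _]/(nat_of_bool _) jn_fm.
    over.
  rewrite exchange_big /=; over.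
rewrite exchange_big; apply: eq_bigr => i _ /=.
rewrite /nfor -!sum1_count big_distrlr /= [RHS]big_mkcond /=.
apply: eq_bigr => x _; case: (cmat x == _); last by rewrite big1.
by rewrite [RHS]big_mkcond; apply: eq_bigr => y _; case: (cmat y == _).
Qed.

Lemma verts_bin l r : verts (bt2pt (BBin l r)) = [::] :: subwords l r.
Proof. by rewrite /= cats0. Qed.

Lemma nfor_leaf ts :
  nfor ts BLeaf = nilp ts + (if ts is [:: PNode [::]] then 1 else 0).
Proof.
rewrite /nfor [subseqs _]/= [count _ _]/= -[X in X + _]/(nat_of_bool (cmat [:: [::]] == fm ts)).
rewrite cmat_root_fm addn0 addnC; congr (nat_of_bool _ + _).
  by rewrite eq_sym fm_eq0.
case: ts => [|[cs] [|t ts]] //; last by case: cs.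
by rewrite eq_sym fm_eq0; case: cs.
Qed.

Lemma nfor_bin ts l r :
  nfor ts (BBin l r) =
  nsplit ts l r + (if ts is [:: PNode cs] then nsplit cs l r else 0).
Proof.
rewrite /nfor verts_bin [subseqs _]/= count_cat count_map count_split addnC.
congr (_ + _); rewrite (eq_count (fun s => cmat_root_fm s ts)).
case: ts => [|[cs] [|t ts]]; rewrite ?count_pred0 //; exact: count_split.
Qed.

Lemma ngood_leaf s : ngood s BLeaf = if s is PNode [::] then 1 else 0.
Proof.
rewrite /ngood [subseqs _]/= [count _ _]/= andbF !addn0 mem_head andbT -fm1.
by rewrite -[[:: [::]]]/(cmat [:: [::]]) cmat_root_fm; case: s => -[|t ts] //; rewrite eq_sym fm_eq0.
Qed.

Lemma ngood_bin cs l r : ngood (PNode cs) (BBin l r) = nsplit cs l r.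
Proof.
rewrite /ngood verts_bin [subseqs _]/= count_cat count_map -fm1 -count_split.
rewrite -[RHS]addn0; congr (_ + _).
  by apply: eq_count => s /=; rewrite mem_head andbT cmat_root_fm.
apply/eqP; rewrite -leqn0 leqNgt -has_count; apply/hasPn => s.
rewrite mem_subseqs negb_and => /mem_subseq sub; apply/orP; right.
by apply/negP => /sub; rewrite mem_cat => /orP[]/mapP[].
Qed.

(** * Sums over binary trees by number of internal nodes *)

Fixpoint inodes (t : btree) : nat :=
  if t is BBin l r then (inodes l + inodes r).+1 else 0.

Lemma bsizeE t : bsize t = (inodes t).*2.+1.
Proof. by elim: t => //= l -> r ->; rewrite doubleS doubleD addSn addnS. Qed.

Lemma Bn_even n : ~~ odd n -> Bn n = [::].
Proof.
rewrite /Bn => en; elim: (bt_size_le n) => //= t s ->.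
by rewrite bsizeE; case: eqP => // nE; rewrite -nE /= odd_double in en.
Qed.

Definition tsum k (h : btree -> nat) : nat := \sum_(t <- Bn k.*2.+1) h t.

(** The bound [N] of the enumeration is independent of [k], because the recursive calls of
    [bt_size_le] do not have the bound matching their own [k]; [bsum_stable] removes it. *)
Definition bsum N k (h : btree -> nat) : nat :=
  \sum_(t <- bt_size_le N | inodes t == k) h t.

Lemma tsumE k h : tsum k h = bsum k.*2.+1 k h.
Proof.
rewrite /tsum /Bn big_filter; apply: eq_bigl => t.
by rewrite bsizeE eqSS -!muln2 eqn_pmul2r.
Qed.

Lemma bsum0 N h : bsum N.+1 0 h = h BLeaf.
Proof.
rewrite /bsum /= big_cons /= big_map big_pred0 ?addn0 //.
Qed.

(** Under the bound on [N] the size filter in the enumeration holds automatically, leaving the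
    convolution over the numbers of internal nodes of the two subtrees. *)
Lemma bsumS N k h : k.+1.*2 <= N ->
  bsum N.+1 k.+1 h =
  \sum_(i < k.+1) bsum N i (fun l => bsum N (k - i) (fun r => h (BBin l r))).
Proof.
move=> kN; rewrite /bsum /= big_cons /= big_map big_filter_cond.
rewrite (eq_bigl (fun p => inodes p.1 + inodes p.2 == k)); last first.
  move=> p /=; rewrite eqSS andb_idl // => /eqP kE.
  by rewrite !bsizeE addSn addnS -doubleD kE.
rewrite big_mkcond big_allpairs /= [RHS](eq_bigr _ (fun i _ => big_mkcond _ _)).
rewrite [RHS]exchange_big /=; apply: eq_bigr => l _.
rewrite -big_mkcond -[RHS]big_mkcond /=.
have [lk|kl] := leqP (inodes l) k.
  rewrite [RHS](big_pred1 (Ordinal (n := k.+1) lk)) => [|i]; last exact: eq_sym.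
  apply: eq_bigl => r /=.
  by rewrite -(eqn_add2l (inodes l) (inodes r)) subnKC.
rewrite !big_pred0 // => [i|r].
  by apply/eqP => lE; move: (ltn_ord i); rewrite ltnS -lE leqNgt kl.
by apply/eqP => kE; rewrite -kE ltnNge leq_addr in kl.
Qed.

Lemma bsum_stable N k h : k.*2 < N -> bsum N k h = tsum k h.
Proof.
rewrite tsumE.
elim/ltn_ind: k N h => -[_|k IH] [|N] h //; first by rewrite !bsum0.
rewrite ltnS => kN; rewrite !bsumS //; apply: eq_bigr => i _.
have ik : i <= k by rewrite -ltnS.
have {}IH j M h' : j <= k -> k.+1.*2 <= M -> bsum M j h' = bsum j.*2.+1 j h'.
  move=> jk kM; apply: IH; rewrite ?ltnS //.
  by apply: leq_trans kM; rewrite doubleS ltnS leqW // leq_double.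
rewrite [LHS]IH // [RHS]IH //; apply: eq_bigr => l _.
by rewrite [LHS]IH ?leq_subr // [RHS]IH ?leq_subr.
Qed.

Lemma tsum0 h : tsum 0 h = h BLeaf.
Proof. by rewrite tsumE bsum0. Qed.

Lemma tsumS k h :
  tsum k.+1 h =
  \sum_(i < k.+1) tsum i (fun l => tsum (k - i) (fun r => h (BBin l r))).
Proof.
rewrite tsumE bsumS //; apply: eq_bigr => i _.
have ik : i <= k by rewrite -ltnS.
rewrite bsum_stable ?ltn_double //; apply: eq_bigr => l _.
by rewrite bsum_stable // ltn_double ltnS leq_subr.
Qed.

(** * Convolution recurrences for the total counts *)

Definition Fcount ts k := tsum k (nfor ts).
Definition Gcount s k := tsum k (ngood s).

Definition Fsplit ts k : nat :=
  \sum_(i < k.+1) \sum_(j < (size ts).+1)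
     Fcount (take j ts) i * Fcount (drop j ts) (k - i).

Lemma tsum_nsplit ts k :
  \sum_(i < k.+1) tsum i (fun l => tsum (k - i) (nsplit ts l)) = Fsplit ts k.
Proof.
apply: eq_bigr => i _; rewrite /tsum /nsplit.
under eq_bigr => l _ do rewrite exchange_big /=.
rewrite exchange_big; apply: eq_bigr => j _ /=.
by rewrite /Fcount /tsum big_distrlr.
Qed.

Lemma Fcount0 ts :
  Fcount ts 0 = nilp ts + (if ts is [:: PNode [::]] then 1 else 0).
Proof. by rewrite /Fcount tsum0 nfor_leaf. Qed.

Lemma FcountS ts k :
  Fcount ts k.+1 = Fsplit ts k + (if ts is [:: PNode cs] then Fsplit cs k else 0).
Proof.
rewrite /Fcount tsumS -tsum_nsplit.
transitivity (\sum_(i < k.+1) (tsum i (fun l => tsum (k - i) (nsplit ts l)) +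
  (if ts is [:: PNode cs] then tsum i (fun l => tsum (k - i) (nsplit cs l)) else 0))).
  apply: eq_bigr => i _.
  case: ts => [|[cs] [|t ts]]; rewrite ?addn0 -?big_split /=; apply: eq_bigr => l _;
    rewrite -?big_split /=; apply: eq_bigr => r _; by rewrite nfor_bin ?addn0.
rewrite big_split; congr (_ + _).
by case: ts => [|[cs] [|t ts]]; rewrite -?tsum_nsplit // big1.
Qed.

Lemma Gcount0 s : Gcount s 0 = if s is PNode [::] then 1 else 0.
Proof. by rewrite /Gcount tsum0 ngood_leaf. Qed.

Lemma GcountS cs k : Gcount (PNode cs) k.+1 = Fsplit cs k.
Proof.
rewrite /Gcount tsumS -tsum_nsplit; apply: eq_bigr => i _.
by apply: eq_bigr => l _; apply: eq_bigr => r _; rewrite ngood_bin.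
Qed.

Lemma aB_odd k s : aB k.*2.+1 s = Fcount [:: s] k.
Proof. by apply: eq_bigr => t _; rewrite n_embE /nfor fm1. Qed.

Lemma gB_odd k s : gB k.*2.+1 s = Gcount s k.
Proof. by apply: eq_bigr => t _; rewrite n_good_embE. Qed.

(** * Vertex and edge counts of a plane tree *)

Lemma degs_size s : size (degs s) = nverts s.
Proof.
rewrite /nverts; elim/ptree_nested_ind: s => ts IH /=; congr _.+1.
rewrite -/(fverts 0 ts); elim: IH 0 => // t {}ts tE _ IHts a.
by rewrite fverts_cons /= !size_cat size_map tE (IHts a.+1).
Qed.

Lemma sumn_degs s : (sumn (degs s)).+1 = size (degs s).
Proof.
elim/ptree_nested_ind: s => ts IH /=; congr _.+1.
elim: IH => // t {}ts tE _ IHts /=.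
by rewrite sumn_cat size_cat -tE -IHts !addSn addnCA.
Qed.

From HB Require Import structures.
From mathcomp Require Import all_algebra ring zify.
From mathcomp Require Import boolp Rstruct.
Import GRing.Theory.

(** * Generating functions *)

Section PowerSeries.
Local Open Scope ring_scope.
Variable K : comNzRingType.

Record fps := Fps { coef : nat -> K }.

Lemma fpsP (a b : fps) : (forall n, coef a n = coef b n) -> a = b.
Proof. by case: a b => [a] [b] /= /funext ->. Qed.

HB.instance Definition _ := gen_eqMixin fps.
HB.instance Definition _ := gen_choiceMixin fps.

Definition fps_add (a b : fps) := Fps (fun n => coef a n + coef b n).
Definition fps_opp (a : fps) := Fps (fun n => - coef a n).
Definition fps_zero := Fps (fun=> 0).
Definition fps_one := Fps (fun n => (n == 0%N)%:R).
Definition fps_mul (a b : fps) :=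
  Fps (fun n => \sum_(i < n.+1) coef a i * coef b (n - i)).

Lemma fps_addA : associative fps_add.
Proof. by move=> a b c; apply: fpsP => n; apply: addrA. Qed.
Lemma fps_addC : commutative fps_add.
Proof. by move=> a b; apply: fpsP => n; apply: addrC. Qed.
Lemma fps_add0 : left_id fps_zero fps_add.
Proof. by move=> a; apply: fpsP => n; apply: add0r. Qed.
Lemma fps_addN : left_inverse fps_zero fps_opp fps_add.
Proof. by move=> a; apply: fpsP => n; apply: addNr. Qed.

HB.instance Definition _ :=
  GRing.isZmodule.Build fps fps_addA fps_addC fps_add0 fps_addN.

Let trunc n (a : fps) : {poly K} := \poly_(i < n.+1) coef a i.

Lemma coef_trunc n a k : (k <= n)%N -> (trunc n a)`_k = coef a k.
Proof. by move=> kn; rewrite coef_poly ltnS kn. Qed.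

(** Coefficients of a Cauchy product up to [n] depend only on truncations, so commutativity and
    associativity come from the polynomial ring. *)
Lemma coef_mul_trunc n a b k :
  (k <= n)%N -> coef (fps_mul a b) k = (trunc n a * trunc n b)`_k.
Proof.
move=> kn; rewrite coefM; apply: eq_bigr => i _.
have ik : (i <= k)%N by rewrite -ltnS.
by rewrite !coef_trunc ?(leq_trans _ kn) ?leq_subr.
Qed.

Lemma fps_mulC : commutative fps_mul.
Proof.
by move=> a b; apply: fpsP => n; rewrite !(coef_mul_trunc _ _ (leqnn n)) mulrC.
Qed.

Lemma fps_mulA : associative fps_mul.
Proof.
move=> a b c; apply: fpsP => n.
transitivity ((trunc n a * (trunc n b * trunc n c))`_n).
  rewrite coefM; apply: eq_bigr => i _.
  by rewrite coef_trunc ?(coef_mul_trunc (n := n)) ?leq_subr // -ltnS.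
rewrite mulrA coefM; apply: eq_bigr => i _.
by rewrite coef_trunc ?leq_subr // (coef_mul_trunc (n := n)) // -ltnS.
Qed.

Lemma fps_mul1 : left_id fps_one fps_mul.
Proof.
move=> a; apply: fpsP => n /=; rewrite big_ord_recl mul1r subn0 big1 ?addr0 //.
by move=> i _; rewrite mul0r.
Qed.

Lemma fps_mulDl : left_distributive fps_mul fps_add.
Proof.
move=> a b c; apply: fpsP => n /=; rewrite -big_split.
by apply: eq_bigr => i _; rewrite mulrDl.
Qed.

Lemma fps_one_neq0 : fps_one != fps_zero.
Proof.
apply/eqP => /(congr1 (fun a => coef a 0)) /= /eqP.
by rewrite (negbTE (oner_neq0 K)).
Qed.

HB.instance Definition _ := GRing.Zmodule_isComNzRing.Build fps
  fps_mulA fps_mulC fps_mul1 fps_mulDl fps_one_neq0.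

Lemma coefD (a b : fps) n : coef (a + b) n = coef a n + coef b n.
Proof. by []. Qed.
Lemma coefB (a b : fps) n : coef (a - b) n = coef a n - coef b n.
Proof. by []. Qed.
Lemma coef1 n : coef (1 : fps) n = (n == 0%N)%:R.
Proof. by []. Qed.
Lemma coefM_fps (a b : fps) n :
  coef (a * b) n = \sum_(i < n.+1) coef a i * coef b (n - i).
Proof. by []. Qed.
Lemma coef_sum (I : Type) (r : seq I) (F : I -> fps) n :
  coef (\sum_(i <- r) F i) n = \sum_(i <- r) coef (F i) n.
Proof. by elim/big_rec2: _ => // i x y _ <-. Qed.
Lemma coef_natmul (c : nat) (a : fps) n : coef (c%:R * a) n = c%:R * coef a n.
Proof.
rewrite !mulr_natl; elim: c => [|c IH]; first by rewrite !mulr0n.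
by rewrite !mulrS coefD IH.
Qed.

Definition fz : fps := Fps (fun n => (n == 1%N)%:R).

Lemma coef_zM0 a : coef (fz * a) 0 = 0.
Proof. by rewrite coefM_fps big_ord_recl big_ord0 mul0r addr0. Qed.

Lemma coef_zMS a n : coef (fz * a) n.+1 = coef a n.
Proof.
rewrite coefM_fps 2!big_ord_recl mul0r add0r mul1r subSS subn0 big1 ?addr0 //.
by move=> i _; rewrite mul0r.
Qed.

Definition theta (a : fps) : fps := Fps (fun n => n%:R * coef a n).

Lemma thetaM a b : theta (a * b) = theta a * b + a * theta b.
Proof.
apply: fpsP => n; rewrite coefD !coefM_fps /= mulr_sumr -big_split.
apply: eq_bigr => i _ /=; have ik : (i <= n)%N by rewrite -ltnS.
have -> : n%:R = i%:R + (n - i)%:R :> K by rewrite -natrD subnKC.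
by ring.
Qed.

Lemma thetaD a b : theta (a + b) = theta a + theta b.
Proof. by apply: fpsP => n; apply: mulrDr. Qed.

Lemma thetaN a : theta (- a) = - theta a.
Proof. by apply: fpsP => n; apply: mulrN. Qed.

Lemma theta1 : theta 1 = 0.
Proof. by apply: fpsP => -[|n] /=; rewrite ?mul0r ?mulr0. Qed.

Lemma theta_z : theta fz = fz.
Proof. by apply: fpsP => -[|[|n]] /=; rewrite ?mul0r ?mulr0 ?mulr1. Qed.

(** * The discriminant series and the coefficients of its inverse powers *)

Section CatalanSeries.
Variable b : fps.
Hypothesis bE : b = 1 + fz * (b * b).

Definition disc : fps := 1 - (fz * b + fz * b).

Lemma disc_sqr : disc * disc = 1 - 4%:R * fz.
Proof.
(* Subtracting the quadratic equation of [b] with multiplier 4z leaves a ring identity. *)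
have H : 4%:R * fz * (b - (1 + fz * (b * b))) = 0 by rewrite -bE subrr mulr0.
rewrite -[RHS]subr0 -H /disc; ring.
Qed.

Definition geom4 : fps := Fps (fun n => 4%:R ^+ n).

Lemma geom4E : (1 - 4%:R * fz) * geom4 = 1.
Proof.
rewrite mulrBl mul1r -mulrA; apply: fpsP => -[|n].
  by rewrite coefB coef_natmul coef_zM0 mulr0 subr0 /= expr0.
by rewrite coefB coef_natmul coef_zMS /= exprS subrr.
Qed.

(** D is inverted explicitly: D^2 = 1 - 4z, and [geom4] is the inverse of 1 - 4z. *)
Definition dinv : fps := disc * geom4.

Lemma disc_dinv : disc * dinv = 1.
Proof. by rewrite mulrA disc_sqr geom4E. Qed.

(** Obtained by differentiating D^2 = 1 - 4z and D * D^(-1) = 1. The factor 2 stays on the left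
    because 2 need not be invertible in [K]. *)
Lemma theta_dinv : 2%:R * ((1 - 4%:R * fz) * theta dinv) = 4%:R * fz * dinv.
Proof.
have dd : disc * theta disc + disc * theta disc = - (4%:R * fz).
  have e : theta (1 - 4%:R * fz) = - theta (4%:R * fz).
    by rewrite thetaD thetaN theta1 add0r.
  have := thetaM disc disc; rewrite disc_sqr e [theta disc * _]mulrC => <-.
  congr (- _); apply: fpsP => n; rewrite -[in RHS]theta_z coef_natmul.
  rewrite -[LHS]/(n%:R * coef (4%:R * fz) n) coef_natmul.
  by rewrite -[coef (theta _) n]/(n%:R * coef fz n); ring.
have di : theta disc * dinv + disc * theta dinv = 0.
  by rewrite -thetaM disc_dinv theta1.
rewrite -disc_sqr -[LHS]subr0.
have -> : 0 = 2%:R * disc * (theta disc * dinv + disc * theta dinv) :> fps.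
  by rewrite di mulr0.
have -> : 4%:R * fz = - (disc * theta disc + disc * theta disc) by rewrite dd opprK.
ring.
Qed.

Lemma theta_dinvX j :
  2%:R * ((1 - 4%:R * fz) * theta (dinv ^+ j)) = j%:R * (4%:R * fz * dinv ^+ j).
Proof.
elim: j => [|j IH]; first by rewrite expr0 theta1 !mulr0 mul0r.
rewrite exprS thetaM.
transitivity (2%:R * ((1 - 4%:R * fz) * theta dinv) * dinv ^+ j +
   dinv * (2%:R * ((1 - 4%:R * fz) * theta (dinv ^+ j)))); first by ring.
by rewrite IH theta_dinv -[in RHS]addn1 natrD; ring.
Qed.

Definition Uc q j n : K := coef ((1 - disc) ^+ q * dinv ^+ j) n.

Lemma Uc_rec q j n : Uc q.+1 j.+1 n = Uc q j.+1 n - Uc q j n.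
Proof.
rewrite -coefB; congr coef.
have -> : (1 - disc) ^+ q * dinv ^+ j = (1 - disc) ^+ q * dinv ^+ j * (disc * dinv).
  by rewrite disc_dinv mulr1.
by rewrite !exprS; ring.
Qed.

Lemma Uc_rec0 q n :
  Uc q.+1 0 n.+1 = Uc q 0 n.+1 - (Uc q 1 n.+1 - 4%:R * Uc q 1 n).
Proof.
rewrite /Uc.
have -> : (1 - disc) ^+ q.+1 * dinv ^+ 0 =
  (1 - disc) ^+ q * dinv ^+ 0 -
  ((1 - disc) ^+ q * dinv ^+ 1 - 4%:R * (fz * ((1 - disc) ^+ q * dinv ^+ 1))).
  transitivity ((1 - disc) ^+ q * (1 - disc * (disc * dinv))).
    by rewrite disc_dinv exprS; ring.
  transitivity ((1 - disc) ^+ q * (1 - (1 - 4%:R * fz) * dinv)).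
    by rewrite -disc_sqr; ring.
  by rewrite !expr0 !expr1; ring.
by rewrite !coefB coef_natmul coef_zMS.
Qed.

Lemma Uc00 j : Uc 0 j 0 = 1.
Proof.
rewrite /Uc expr0 mul1r; elim: j => [|j IH]; first by rewrite expr0.
rewrite exprS coefM_fps big_ord_recl big_ord0 IH addr0 mulr1.
rewrite /dinv coefM_fps big_ord_recl big_ord0 addr0 mulr1 /disc.
by rewrite coefB coefD coef_zM0 !addr0 subr0.
Qed.

Lemma Uc_ode j n :
  (2 * n.+1)%:R * Uc 0 j n.+1 = (4 * (2 * n + j))%:R * Uc 0 j n.
Proof.
rewrite /Uc expr0 !mul1r.
have := congr1 (fun a => coef a n.+1) (theta_dinvX j).
rewrite mulrBl mul1r -!mulrA !coef_natmul !coef_zMS coefB coef_natmul coef_zMS.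
rewrite /= mulrBr => /eqP; rewrite subr_eq => /eqP E.
by rewrite natrM -mulrA E !natrM natrD natrM; ring.
Qed.

Lemma Uc1S n : Uc 1 0 n.+1 = 2%:R * coef b n.
Proof.
rewrite /Uc expr0 mulr1 expr1.
have -> : 1 - disc = 2%:R * (fz * b) by rewrite /disc; ring.
by rewrite coef_natmul coef_zMS.
Qed.

(** From 1 - D = 2zb and D = (1 - 4z) D^(-1), 2 b_n is a combination of two consecutive coefficients
    of 1/D; [Uc_ode] eliminates the lower one. *)
Lemma Uc_base n : (2 * (2 * n + 1))%:R * coef b n = Uc 0 1 n.+1.
Proof.
have E0 : Uc 0 0 n.+1 = 0 by rewrite /Uc !expr0 mulr1 coef1.
transitivity ((2 * n + 1)%:R * Uc 1 0 n.+1).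
  by rewrite Uc1S natrM; ring.
rewrite Uc_rec0 E0.
transitivity ((4 * (2 * n + 1))%:R * Uc 0 1 n - (2 * n + 1)%:R * Uc 0 1 n.+1).
  by rewrite natrM; ring.
rewrite -Uc_ode -mulrBl (_ : 2 * n.+1 = (2 * n + 1).+1)%N; last by rewrite mulnS addn1.
by rewrite -addn1 [(_ + 1 + 1)%:R]natrD addrAC subrr add0r mul1r.
Qed.
End CatalanSeries.
End PowerSeries.

(** * Functional equations of the embedding series *)

Section EmbeddingSeries.
Local Open Scope ring_scope.
Variable K : comNzRingType.

Definition gfF ts : fps K := Fps (fun k => (Fcount ts k)%:R).
Definition gfG s : fps K := Fps (fun k => (Gcount s k)%:R).
Definition gsplit ts : fps K :=
  \sum_(j < (size ts).+1) gfF (take j ts) * gfF (drop j ts).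

Lemma coef_gsplit ts k : coef (gsplit ts) k = (Fsplit ts k)%:R.
Proof.
rewrite /Fsplit exchange_big natr_sum coef_sum; apply: eq_bigr => j _.
by rewrite natr_sum; apply: eq_bigr => i _; rewrite natrM.
Qed.

Lemma gfF_eq ts : (if ts is [:: t] then false else true) ->
  gfF ts = (nilp ts)%:R + fz K * gsplit ts.
Proof.
move=> ts1; apply: fpsP => -[|k]; rewrite coefD ?coef_zM0 ?coef_zMS.
  rewrite /= Fcount0 addr0; by case: ts ts1 => [|[[|? ?]] [|t' ts]].
rewrite /= FcountS coef_gsplit.
have -> : coef ((nilp ts)%:R : fps K) k.+1 = 0 by case: (nilp ts).
by rewrite add0r; case: ts ts1 => [|[cs] [|t' ts]] _ //=; rewrite addn0.
Qed.

Lemma gfG_eq cs : gfG (PNode cs) = (nilp cs)%:R + fz K * gsplit cs.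
Proof.
apply: fpsP => -[|k]; rewrite coefD ?coef_zM0 ?coef_zMS /=.
  by rewrite Gcount0 addr0; case: cs.
rewrite GcountS coef_gsplit.
have -> : coef ((nilp cs)%:R : fps K) k.+1 = 0 by case: (nilp cs).
by rewrite add0r.
Qed.

Lemma gfF1_eq s : gfF [:: s] = gfG s + fz K * gsplit [:: s].
Proof.
apply: fpsP => -[|k]; rewrite coefD ?coef_zM0 ?coef_zMS /=.
  by rewrite Fcount0 Gcount0 addr0.
by case: s => cs; rewrite FcountS GcountS coef_gsplit addnC natrD.
Qed.

Let b := gfF [::].

Lemma gfF0_eq : b = 1 + fz K * (b * b).
Proof. by rewrite {1}/b gfF_eq // /gsplit big_ord_recl big_ord0 /= addr0. Qed.

Let D := disc b.
Let I := dinv b.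
Let DI : D * I = 1 := disc_dinv gfF0_eq.

(** The two extreme cuts send the whole forest into one subtree and contribute [b * F] twice. Moved
    to the left they produce the factor D; [M] collects the interior cuts. *)
Lemma disc_solve G F M : F = G + fz K * (b * F + (M + F * b)) ->
  D * F = G + fz K * M.
Proof.
move=> FE.
have H : F - (G + fz K * (b * F + (M + F * b))) = 0 by rewrite -FE subrr.
by rewrite -[RHS]addr0 -H /D /disc; ring.
Qed.

Lemma gfF1 s : gfF [:: s] = I * gfG s.
Proof.
have -> : gfG s = D * gfF [:: s].
  rewrite (@disc_solve (gfG s) _ 0) ?mulr0 ?addr0 // add0r {1}gfF1_eq.
  by rewrite /gsplit 2!big_ord_recl big_ord0 /= addr0.
by rewrite mulrA [I * D]mulrC DI mul1r.
Qed.

End EmbeddingSeries.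

(** The ratio of consecutive central binomial coefficients, in the form that matches [Uc_ode] at
    [j = 1]. *)
Lemma central_bin n :
  (n.+1 * 'C(n.+1.*2, n.+1) = 2 * (n.*2.+1 * 'C(n.*2, n)))%N.
Proof.
rewrite doubleS binS -[X in 'C(_, n.+1) + X]bin_sub; last first.
  by rewrite leqW // -addnn leq_addr.
have -> : (n.*2.+1 - n = n.+1)%N by rewrite -addnn -addnS addKn.
by rewrite addnn -muln2 mulnA -[n.*2.+1 in RHS]/(n.*2.+1) -mul_bin_diag mulnC.
Qed.

(** * Identification of the number of binary trees with the Catalan numbers *)

Section CatalanNumbers.
Local Open Scope ring_scope.

(** Over the integers the coefficients of 1/D are the central binomials, by equality of recurrences,
    and [Uc_base] relates them to [b]. The product form also shows that the division in [catalan] is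
    exact. *)
Lemma mul_Fcount_nil k : (k.+1 * Fcount [::] k = 'C(k.*2, k))%N.
Proof.
pose b := gfF int [::]; have bE : b = 1 + fz _ * (b * b) := gfF0_eq int.
have UE n : Uc b 0 1 n = 'C(n.*2, n)%:R :> int.
  elim: n => [|n IH]; first by rewrite Uc00.
  have n0 : (2 * n.+1)%:R != 0 :> int by rewrite natz; lia.
  apply: (mulfI n0).
  rewrite (Uc_ode bE) IH -!natrM -[in RHS]mulnA central_bin; congr _%:R.
  by move: ('C(_, _)) => c; nia.
have := Uc_base bE k; rewrite UE /=.
have := central_bin k; nia.
Qed.

Lemma catalan_eq k : catalan k = Fcount [::] k.
Proof. by rewrite /catalan -mul_Fcount_nil mulKn. Qed.

Lemma catalan_gt0 k : (0 < catalan k)%N.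
Proof.
have : (0 < k.+1 * Fcount [::] k)%N.
  by rewrite mul_Fcount_nil bin_gt0 -addnn leq_addr.
by rewrite muln_gt0 catalan_eq => /andP[].
Qed.

End CatalanNumbers.

(** * Product formula over the vertices of the tree *)

Section EmbeddingSeriesForest.
Local Open Scope ring_scope.
Variable K : comNzRingType.
Local Notation gfF := (gfF K).
Local Notation gfG := (gfG K).
Local Notation gsplit := (gsplit K).

Lemma catalanS k :
  catalan k.+1 = (\sum_(i < k.+1) catalan i * catalan (k - i))%N.
Proof.
rewrite catalan_eq FcountS addn0; apply: eq_bigr => i _.
by rewrite big_ord_recl big_ord0 addn0 !catalan_eq.
Qed.

Let b := gfF [::].
Let D := disc b.
Let I := dinv b.
Let DI : D * I = 1 := disc_dinv (gfF0_eq K).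
Let gfF1I s : gfF [:: s] = I * gfG s := gfF1 K s.

(** Separating [r + 1] trees takes [r] proper cuts, each contributing z/D, and the patterns of cuts
    are the binary trees with [r] internal nodes. In the induction, the interior cuts combine
    through the Catalan convolution. *)
Lemma gfF_forest ts r : size ts = r.+1 ->
  gfF ts = (catalan r)%:R * (fz K * I) ^+ r * \prod_(t <- ts) gfF [:: t].
Proof.
elim/ltn_ind: r ts => -[|r] IH ts sz.
  case: ts sz => [|t []] // _.
  by rewrite big_seq1 expr0 mulr1 (_ : catalan 0 = 1%N) ?mul1r.
have [t [t' [ts' tsE]]] : exists t t' ts', ts = [:: t, t' & ts'].
  by case: ts sz => [|t [|t' ts']] // _; exists t, t', ts'.
have FE : gfF ts = fz K * gsplit ts by rewrite gfF_eq tsE //= add0r.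
pose M := \sum_(j < r.+1) gfF (take j.+1 ts) * gfF (drop j.+1 ts).
have SE : gsplit ts = b * gfF ts + (M + gfF ts * b).
  rewrite /gsplit sz big_ord_recl big_ord_recr /= take0 drop0.
  by rewrite /bump add1n -sz take_size drop_size.
have DF : D * gfF ts = fz K * M.
  by rewrite (@disc_solve K 0 _ M) ?add0r // -SE.
have ME : M = (catalan r.+1)%:R * (fz K * I) ^+ r * \prod_(t <- ts) gfF [:: t].
  rewrite catalanS natr_sum !mulr_suml; apply: eq_bigr => j _.
  have jr : (j <= r)%N by rewrite -ltnS.
  rewrite (IH j) ?ltnS ?size_takel ?sz ?ltnS ?leqW //.
  rewrite (IH (r - j)%N) ?ltnS ?leq_subr // ?size_drop ?sz ?subSS ?subSn //.
  rewrite -[in RHS](cat_take_drop j.+1 ts) big_cat /= natrM.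
  have -> : (fz K * I) ^+ r = (fz K * I) ^+ j * (fz K * I) ^+ (r - j).
    by rewrite -exprD subnKC.
  by ring.
have -> : gfF ts = I * (D * gfF ts) by rewrite mulrA [I * D]mulrC DI mul1r.
by rewrite DF ME exprS; ring.
Qed.

(** With one child, both cuts are extreme and give 2zb = 1 - D. With at least two children, using
    the root and then cutting counts the same as embedding the forest of children, so [gfF_forest]
    applies. *)
Lemma gfG_node t ts : gfG (PNode (t :: ts)) =
  (catalan (size ts))%:R * (1 - D) ^+ nilp ts * fz K ^+ (size ts) *
  I ^+ (size ts).*2.+1 * \prod_(t' <- t :: ts) gfG t'.
Proof.
rewrite gfG_eq add0r; case: ts => [|t' ts].
  rewrite /gsplit 2!big_ord_recl big_ord0 /= -/b big_seq1 gfF1I.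
  by rewrite expr0 !expr1 (_ : catalan 0 = 1%N) // /D /disc; ring.
rewrite -[LHS]add0r -[X in X + _]/((nilp [:: t, t' & ts])%:R) -gfF_eq //.
rewrite (@gfF_forest _ (size ts).+1) // (eq_bigr _ (fun t _ => gfF1I t)).
rewrite big_split big_const_seq count_predT /= iter_mulr_1 mulr1.
have -> : (size (t' :: ts)).*2.+1 = ((size ts).+1 + (size ts).+2)%N.
  by rewrite [RHS]addnS addnn.
by rewrite exprD exprMn !exprS; ring.
Qed.

(** The truncated predecessors matter at [d = 0]: the exponent of 1/D is 0 and the Catalan factor is
    1, leaving 1 - D for a leaf. *)
Definition wt d := (catalan d.-1)%:R * (1 - D) ^+ (d <= 1)%N * I ^+ (d.*2.-1).

(** For a leaf, 2zG = 2zb = 1 - D. At a vertex with d children the d factors z, one of them from the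
    left side, are distributed to the children, while the factors 2 occur only at leaves. *)
Lemma gfG_degs s :
  2%:R ^+ nleaves s * fz K * gfG s = \prod_(d <- degs s) wt d.
Proof.
elim/ptree_nested_ind: s => -[|t ts] IH.
  rewrite big_seq1 gfG_eq /wt /= expr1 expr0 (_ : catalan 0 = 1%N) //.
  rewrite /nleaves /dcount /= expr1 /gsplit big_ord_recl big_ord0 /= -/b addr0.
  by rewrite -gfF0_eq -/b /D /disc; ring.
rewrite [degs _]/= big_cons.
have -> : \prod_(d <- flatten (map degs (t :: ts))) wt d =
    \prod_(t' <- t :: ts) (2%:R ^+ nleaves t' * fz K * gfG t').
  rewrite big_flatten big_map; elim: IH => [|t' ts' E _ IHts].
    by rewrite !big_nil.
  by rewrite !big_cons IHts E.
rewrite gfG_node !big_split /= big_const_seq count_predT iter_mulr_1.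
have -> : \prod_(t' <- t :: ts) 2%:R ^+ nleaves t' =
    2%:R ^+ nleaves (PNode (t :: ts)) :> fps K.
  rewrite prodrXr; congr (_ ^+ _).
  transitivity (count (pred1 0%N) (flatten (map degs (t :: ts)))); last by [].
  by rewrite count_flatten sumnE !big_map.
rewrite /wt [size _]/= doubleS ltnS leqn0 -/(nilp ts) [(size ts).+1.-1]/=.
by rewrite [fz K ^+ (size ts).+1]exprS [(size ts).*2.+2.-1]/=; ring.
Qed.

Definition degw s := (\sum_(d <- degs s) d.*2.-1)%N.
Definition degq s := (\sum_(d <- degs s) (d <= 1))%N.
Definition degC s := (\prod_(d <- degs s) catalan d.-1)%N.

Lemma prod_wt s :
  \prod_(d <- degs s) wt d = (degC s)%:R * ((1 - D) ^+ degq s * I ^+ degw s).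
Proof. by rewrite !big_split /= -natr_prod -!prodrXr mulrA. Qed.

Lemma Gcount_Uc s k : 2%:R ^+ nleaves s * (Gcount s k)%:R =
  (degC s)%:R * Uc b (degq s) (degw s) k.+1.
Proof.
rewrite -coef_natmul -prod_wt -gfG_degs -!natrX -mulrA coef_natmul coef_zMS.
by [].
Qed.

Lemma Fcount_Uc s k : 2%:R ^+ nleaves s * (Fcount [:: s] k)%:R =
  (degC s)%:R * Uc b (degq s) (degw s).+1 k.+1.
Proof.
have -> : (degC s)%:R * Uc b (degq s) (degw s).+1 k.+1 =
    coef (I * \prod_(d <- degs s) wt d) k.+1.
  rewrite prod_wt mulrCA coef_natmul; congr (_ * coef _ _).
  by rewrite -/D -/I exprS; ring.
rewrite -gfG_degs.
rewrite [I * _](_ : _ = 2%:R ^+ nleaves s * (fz K * (I * gfG s))); last by ring.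
by rewrite -gfF1I -!natrX coef_natmul coef_zMS.
Qed.
End EmbeddingSeriesForest.

(** * The exponents and the constant in terms of the degree sequence *)

Section DegreeSequence.

(** The degrees sum to m - 1, and truncation makes each leaf contribute 0 instead of -1, so the
    exponents sum to 2(m - 1) - m + l. *)
Lemma degw_eq s : degw s + 2 = nverts s + nleaves s.
Proof.
have E : degw s + size (degs s) = (sumn (degs s)).*2 + nleaves s.
  rewrite /degw /nleaves /dcount; elim: (degs s) => [|d r IH]; first by rewrite big_nil.
  rewrite big_cons /=; move: (\sum_(_ <- _) _) (sumn r) (count _ r) IH => a b c.
  case: d => [|d] /=; lia.
have := sumn_degs s; rewrite -degs_size; lia.
Qed.

Lemma degs_lt s : all (fun d => d < size (degs s)) (degs s).
Proof.
apply/allP => d; rewrite -sumn_degs ltnS.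
elim: (degs s) => //= e r IH; rewrite inE => /orP[/eqP->|/IH]; first exact: leq_addr.
by move=> dr; apply: leq_trans dr (leq_addl _ _).
Qed.

(** Degrees 0, 1 and 2 contribute a Catalan number equal to 1, and every degree is below the number
    of vertices, so the product over 3 <= i < m loses no factor. *)
Lemma degC_eq s : degC s = \prod_(3 <= i < nverts s) catalan i.-1 ^ dcount s i.
Proof.
rewrite /degC /dcount -degs_size; have := degs_lt s.
move: (size (degs s)) => N; elim: (degs s) => [|d r IH] /=.
  by rewrite big_nil big1.
move=> /andP[dN /IH rN]; rewrite big_cons rN.
rewrite (eq_bigr _ (fun i _ => expnD _ _ _)) big_split; congr (_ * _).
have [d3|d3] := ltnP d 3.
  rewrite big_nat_cond big1 => [|i /andP[/andP[i3 _] _]].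
    by case: d d3 {dN} => [|[|[]]].
  by rewrite (ltn_eqF (leq_trans d3 i3)).
rewrite (bigD1_seq d) ?iota_uniq ?mem_index_iota ?d3 //= eqxx expn1.
by rewrite big1 ?muln1 // => i /negbTE id; rewrite eq_sym id.
Qed.

Lemma degC_gt0 s : 0 < degC s.
Proof. by apply: prodn_gt0 => d; apply: catalan_gt0. Qed.

End DegreeSequence.

(** * Specialization to real coefficients *)

Section RealCoefficients.
Local Open Scope R_scope.

Definition uR q j k : R := Uc (gfF R [::]) q j k.

Lemma uR0 j : uR 0 j 0 = 1.
Proof. exact: Uc00. Qed.

Lemma uRS j n :
  INR (2 * n.+1) * uR 0 j n.+1 = INR (4 * (2 * n + j)) * uR 0 j n.
Proof. by rewrite !INRE; apply: (Uc_ode (gfF0_eq R)). Qed.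

Lemma uR_step q j n : uR q.+1 j.+1 n = uR q j.+1 n - uR q j n.
Proof. exact: (Uc_rec (gfF0_eq R)). Qed.

Lemma uR_step0 q n :
  uR q.+1 0 n.+1 = uR q 0 n.+1 - (uR q 1 n.+1 - 4 * uR q 1 n).
Proof.
rewrite (_ : 4 = INR 4); last by rewrite /=; lra.
by rewrite INRE; apply: (Uc_rec0 (gfF0_eq R)).
Qed.

Lemma uR_catalan k : 2 * (2 * INR k + 1) * INR (Fcount [::] k) = uR 0 1 k.+1.
Proof.
have -> : 2 * (2 * INR k + 1) = INR (2 * (2 * k + 1)).
  by rewrite mult_INR plus_INR mult_INR /=; lra.
by rewrite !INRE; apply: (Uc_base (gfF0_eq R)).
Qed.

Lemma Gcount_uR s k :
  2 ^ nleaves s * INR (Gcount s k) = INR (degC s) * uR (degq s) (degw s) k.+1.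
Proof.
rewrite (_ : 2 = INR 2); last by rewrite /=; lra.
by rewrite RpowE !INRE; apply: (Gcount_Uc R).
Qed.

Lemma Fcount_uR s k : 2 ^ nleaves s * INR (Fcount [:: s] k) =
  INR (degC s) * uR (degq s) (degw s).+1 k.+1.
Proof.
rewrite (_ : 2 = INR 2); last by rewrite /=; lra.
by rewrite RpowE !INRE; apply: (Fcount_Uc R).
Qed.

Lemma Cconst_eq s : Cconst s = INR (degC s).
Proof.
rewrite degC_eq /Cconst (big_morph INR mult_INR (erefl (INR 1))).
apply: eq_bigr => i _.
by elim: (dcount s i) => //= n ->; rewrite expnS mult_INR.
Qed.

Lemma degw_INR s : INR (degw s) = INR (nverts s) + INR (nleaves s) - 2.
Proof. by rewrite -plus_INR plusE -degw_eq plus_INR /=; lra. Qed.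

(** Exponent 0 forces a single vertex, whose only good embedding in each binary tree is the root;
    both sides count trees. *)
Lemma Gcount_leaf_of_degw s : degw s = 0%N ->
  forall k, Gcount s k = Fcount [::] k.
Proof.
case: s => -[_ [|k]|t ts]; first by rewrite Gcount0 Fcount0.
  by rewrite GcountS FcountS addn0.
by rewrite /degw big_cons.
Qed.
End RealCoefficients.

(** * Assembly of the asymptotic formulas *)

Open Scope R_scope.

Theorem theorem2 (S : ptree) :
  (1 <= nverts S)%nat ->
  let m := INR (nverts S) in
  let l := INR (nleaves S) in
  let C := Cconst S in
  (forall n : nat, ~~ odd n -> aB n S = 0%nat /\ gB n S = 0%nat) /\
  asymp_odd (fun n => INR (aB n S))
    (fun n => C * Rpower 2 ((5 - m - 3 * l) / 2) / Gamma ((m + l - 1) / 2)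
              * 2 ^ n * Rpower (INR n) ((m + l - 3) / 2)) /\
  (0 < m + l - 2 ->
   asymp_odd (fun n => INR (gB n S))
    (fun n => C * Rpower 2 ((6 - m - 3 * l) / 2) / Gamma ((m + l - 2) / 2)
              * 2 ^ n * Rpower (INR n) ((m + l - 4) / 2))) /\
  (m + l - 2 = 0 ->
   asymp_odd (fun n => INR (gB n S))
    (fun n => sqrt 2 * 2 ^ n / sqrt (PI * INR n ^ 3))).
Proof.
move=> _ m l C.
have W : INR (degw S) = m + l - 2 := degw_INR S.
have oddE k : (2 * k + 1 = k.*2.+1)%N by rewrite mul2n addn1.
rewrite /asymp_odd.
split; first by move=> n en; rewrite /aB /gB Bn_even // !big_nil.
split; [|split] => [|pos|zero].
(* Here the exponent of 1/D is [(degw S).+1], that is m + l - 1, which is always positive. *)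
- have A := asymp_of_coefficient uR0 uRS uR_step uR_step0 (degC_gt0 S) (Fcount_uR S).
  refine (is_lim_seq_ext _ _ _ _ A) => k.
  rewrite -[INR (degw S).+1]/(INR (degw S).+1) S_INR W -Cconst_eq -/C -/l.
  rewrite [in RHS]oddE aB_odd -oddE; congr (_ / (_ * Rpower 2 _ / Gamma _ * _ * Rpower _ _)); lra.
(* Good embeddings have one factor 1/D fewer; m + l - 2 > 0 makes the exponent a successor, as
   [asymp_of_coefficient] requires. *)
- have [j jE] : exists j, degw S = j.+1.
    by case: (degw S) W => [|j] W; [exfalso; rewrite /= in W; lra|exists j].
  have E := Gcount_uR S; rewrite jE in E W.
  have A := asymp_of_coefficient uR0 uRS uR_step uR_step0 (degC_gt0 S) E.
  refine (is_lim_seq_ext _ _ _ _ A) => k.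
  rewrite W -Cconst_eq -/C -/l.
  rewrite [in RHS]oddE gB_odd -oddE; congr (_ / (_ * Rpower 2 _ / Gamma _ * _ * Rpower _ _)); lra.
(* In the remaining case the count is a Catalan number, estimated through the coefficients of 1/D,
   whose normalized limit is 1/Gamma(1/2). *)
have w0 : degw S = 0%N by apply: INR_eq; rewrite W zero.
have pl : is_lim_seq (fun k => uR 0 1 k.+1 / 4 ^ k.+1 * sqrt (INR k.+1)) (/ sqrt PI).
  rewrite -gammah1; refine (is_lim_seq_ext _ _ _ _ (unorm_lim0 uR0 uRS (j := 0))) => k.
  exact: unorm_one.
refine (is_lim_seq_ext _ _ _ _ (asymp_catalan pl uR_catalan)) => k.
by rewrite [in RHS]oddE gB_odd -oddE Gcount_leaf_of_degw.
Qed.
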